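(* Let $n\ge 3$ and $\mathbb{D}\in\{\mathbb{R},\mathbb{C},\mathbb{H},\mathbb{O}\}$, with $\mathbb{D}=\mathbb{O}$ only for $n=3$. Put $p=\frac{(n-2)(n^2-n-1)}{2}$ and $q=(n-1)(n^2-n-1)$, and let $B\colon H_n(\mathbb{D})\to H_n(\mathbb{D})$ be the linear map which sends a hermitian matrix $X=[x_{lm}]_{l,m=1}^n$ (so $x_{ml}=\overline{x_{lm}}$) to the hermitian matrix $B(X)$ with entries $$B(X)_{11}=x_{22}-x_{11},\qquad B(X)_{ll}=(n-1)^2(x_{l+1,l+1}-x_{ll})\ \ (2\le l\le n-1),\qquad B(X)_{nn}=(n-1)^2(x_{11}-x_{nn}),$$ $$B(X)_{1m}=-p\,x_{1m},\quad B(X)_{m1}=-p\,\overline{x_{1m}}\ \ (2\le m\le n),\qquad B(X)_{lm}=-q\,x_{lm},\quad B(X)_{ml}=-q\,\overline{x_{lm}}\ \ (2\le l<m\le n).$$ Then $B$ is a generator of a one-parameter semigroup of positive maps on $H_n(\mathbb{D})$, i.e. $e^{tB}(H_n(\mathbb{D})^+)\subseteq H_n(\mathbb{D})^+$ for all $t\ge 0$, but $B$ does not belong to the sum $\mathrm{End}(H_n(\mathbb{D})^+)+\mathfrak{g}(H_n(\mathbb{D})^+)$.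
   Context: $\mathbb{R},\mathbb{C},\mathbb{H},\mathbb{O}$ are the real numbers, complex numbers, quaternions and octonions, with the usual conjugation $x\mapsto\overline{x}$. $H_n(\mathbb{D})$ is the real vector space of $n\times n$ hermitian matrices over $\mathbb{D}$ ($X^*=\overline{X}^T=X$); it is a Euclidean Jordan algebra with product $X\circ Y=\frac12(XY+YX)$ and scalar product $\langle X,Y\rangle=\mathrm{Re}\,\mathrm{Tr}(X\circ Y)$. $H_n(\mathbb{D})^+=\{X\circ X: X\in H_n(\mathbb{D})\}$ is the cone of positive semidefinite matrices. For a closed cone $C$ in a finite-dimensional real vector space $V$: $\mathrm{End}(C)$ is the set of linear maps $A:V\to V$ with $A(C)\subseteq C$; $G(C)$ is the group of bijective linear maps $A:V\to V$ with $A(C)=C$; and $\mathfrak{g}(C)$ is the set of linear maps $A:V\to V$ with $e^{tA}\in G(C)$ for all $t\in\mathbb{R}$. The sum $\mathrm{End}(C)+\mathfrak{g}(C)$ is the set of all $A_1+A_2$ with $A_1\in\mathrm{End}(C)$, $A_2\in\mathfrak{g}(C)$. *)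

(* Defs.v *)
From HB Require Import structures.
From mathcomp Require Import all_boot all_order all_algebra.
From mathcomp Require Import all_classical all_reals all_analysis.

Set Implicit Arguments.
Unset Strict Implicit.
Unset Printing Implicit Defensive.

Import Order.TTheory GRing.Theory Num.Theory.
Import numFieldNormedType.Exports.

Local Open Scope classical_set_scope.
Local Open Scope ring_scope.

(** Cayley-Dickson doubling: for [k = 0, 1, 2, 3] these are the reals, complex
    numbers, quaternions and octonions. There is no MathComp ring structure on
    them because the octonions are not associative. *)
Fixpoint cayley_dickson (R : realType) (k : nat) : vectType R :=
  match k with
  | 0%N => R^o
  | k'.+1 => (cayley_dickson R k' * cayley_dickson R k')%type
  end.

Fixpoint cd_conj (R : realType) (k : nat) :
    cayley_dickson R k -> cayley_dickson R k :=
  match k with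
  | 0%N => fun x => x
  | k'.+1 => fun x => (cd_conj x.1, - x.2)
  end.

Fixpoint cd_mul (R : realType) (k : nat) :
    cayley_dickson R k -> cayley_dickson R k -> cayley_dickson R k :=
  match k with
  | 0%N => fun x y : R => x * y
  | k'.+1 => fun x y =>
      (cd_mul x.1 y.1 - cd_mul (cd_conj y.2) x.2,
       cd_mul y.2 x.1 + cd_mul x.2 (cd_conj y.1))
  end.

Section ConjTheory.
Variables (R : realType) (k : nat).

Lemma cd_conj_is_linear : linear (@cd_conj R k).
Proof.
elim: k => [|k' IH] //= a x y.
by rewrite IH opprD -scalerN.
Qed.

HB.instance Definition _ := GRing.isLinear.Build R (cayley_dickson R k)
  (cayley_dickson R k) *:%R (@cd_conj R k) cd_conj_is_linear.

Lemma cd_conjK : involutive (@cd_conj R k).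
Proof. by elim: k => [|k' IH] //= [x y] /=; rewrite IH opprK. Qed.

End ConjTheory.

(** Matrices are finite functions on pairs of indices: unlike ['M_n], this is a
    [vectType R] as soon as the entries are taken in one. *)
Notation cdmx R k n := {ffun 'I_n * 'I_n -> cayley_dickson R k}.

Section HermitianMatrices.
Variables (R : realType) (k n : nat).
Implicit Types X Y : cdmx R k n.

Definition cd_mulmx X Y : cdmx R k n :=
  [ffun ij => \sum_j cd_mul (X (ij.1, j)) (Y (j, ij.2))].

Definition jordan_mul X Y : cdmx R k n :=
  2^-1 *: (cd_mulmx X Y + cd_mulmx Y X).

Definition adjmx X : cdmx R k n := [ffun ij => cd_conj (X (ij.2, ij.1))].

Lemma adjmx_is_linear : linear adjmx.
Proof. by move=> a X Y; apply/ffunP => ij; rewrite !ffunE linearP. Qed.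

HB.instance Definition _ := GRing.isLinear.Build R (cdmx R k n) (cdmx R k n)
  *:%R adjmx adjmx_is_linear.

Definition herm_mx : {vspace cdmx R k n} := lker (linfun adjmx - \1%VF).

Lemma herm_mxP X : reflect (adjmx X = X) (X \in herm_mx).
Proof.
by rewrite memv_ker add_lfunE opp_lfunE id_lfunE lfunE subr_eq0; exact: eqP.
Qed.

Definition psd_cone : set (subvs_of herm_mx) :=
  [set Y | exists X : subvs_of herm_mx,
     vsval Y = jordan_mul (vsval X) (vsval X)].

End HermitianMatrices.

Arguments herm_mx : clear implicits.
Arguments psd_cone : clear implicits.

(** The limit for the canonical topology of a finite-dimensional real vector
    space, i.e. coordinatewise in some (equivalently, any) basis. *)
Definition vlim (R : realType) (V : vectType R) (u : nat -> V) : V :=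
  let e := vbasis {:V} in
  \sum_(i < \dim {:V}) limn (fun N => coord e i (u N)) *: e`_i.

Section ConeOperators.
Variables (R : realType) (V : vectType R).
Implicit Types (A : 'End(V)) (C : set V).

Definition lexp A : 'End(V) :=
  vlim (fun N => \sum_(k < N) (k`!%:R)^-1 *: iter k (comp_lfun A) \1%VF).

Definition cone_End C : set 'End(V) := [set A : 'End(V) | A @` C `<=` C].

Definition cone_G C : set 'End(V) := [set A : 'End(V) | bijective A /\ A @` C = C].

Definition cone_g C : set 'End(V) :=
  [set A : 'End(V) | forall t : R, cone_G C (lexp (t *: A))].

End ConeOperators.

Section Generator.
Variables (R : realType) (k n : nat).

Definition pcoef : R := (n%:R - 2) * (n%:R ^+ 2 - n%:R - 1) / 2.
Definition qcoef : R := (n%:R - 1) * (n%:R ^+ 2 - n%:R - 1).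

(** Indices run over [0, ..., n - 1], and [ordS] is the cyclic successor. *)
Definition Bmx (X : cdmx R k n) : cdmx R k n :=
  [ffun lm : 'I_n * 'I_n =>
     let l := lm.1 in let m := lm.2 in
     if l == m then
       (if l == 0%N :> nat then 1 else (n%:R - 1) ^+ 2)
         *: (X (ordS l, ordS l) - X (l, l))
     else if (l < m)%N then
       (if l == 0%N :> nat then - pcoef else - qcoef) *: X (l, m)
     else
       (if m == 0%N :> nat then - pcoef else - qcoef) *: cd_conj (X (m, l))].

Lemma Bmx_is_linear : linear Bmx.
Proof.
move=> a X Y; apply/ffunP => -[l m]; rewrite !ffunE /=.
case: (l == m); last case: (l < m)%N.
- by rewrite !ffunE opprD addrACA -scalerBr scalerDr !scalerA mulrC.
- by rewrite !ffunE scalerDr !scalerA mulrC.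
- by rewrite !ffunE linearP scalerDr !scalerA mulrC.
Qed.

HB.instance Definition _ := GRing.isLinear.Build R (cdmx R k n) (cdmx R k n)
  *:%R Bmx Bmx_is_linear.

Lemma Bmx_herm X : X \in herm_mx R k n -> Bmx X \in herm_mx R k n.
Proof.
move=> /herm_mxP XE; apply/herm_mxP/ffunP => -[l m]; rewrite !ffunE /=.
have diag i : cd_conj (X (i, i)) = X (i, i) by rewrite -{2}XE ffunE.
rewrite (eq_sym m l); have [<-|neq] := eqVneq l m.
  by rewrite linearZ linearB /= !diag.
have [lm|ml|/val_inj lm] := ltngtP l m; rewrite ?linearZ /= ?cd_conjK //.
by rewrite lm eqxx in neq.
Qed.

Definition genB : 'End(subvs_of (herm_mx R k n)) :=
  linfun (vsproj (herm_mx R k n) \o Bmx \o vsval).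

Lemma genBE X : vsval (genB X) = Bmx (vsval X).
Proof. by rewrite lfunE /= vsprojK // Bmx_herm // subvsP. Qed.

End Generator.

Arguments genB : clear implicits.

(* Main.v *)
From HB Require Import structures.
Require Import Defs.
From mathcomp Require Import all_boot all_order all_algebra.
From mathcomp Require Import all_classical all_reals all_analysis.
From mathcomp Require Import ring lra.

(** Self-duality. Hermitian matrices form a Euclidean Jordan algebra. The trace
    form is associative over every Cayley-Dickson algebra ([mxip_jordan_mul]). The
    Jordan identity is formal when the coefficients are associative
    ([cd_assoc_jordan_law]); for octonionic matrices of order three it follows
    from the alternative and Moufang laws ([cubic_jordan_law]). These properties
    alone imply that the cone K of squares is its own dual ([ip_sqr_sqr],
    [dual_psd_square]), and that an element z of K with [<z, y^2> = 0] satisfies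
    [z y = 0] and [z y^2 = 0] ([dual_psd_orth], [dual_psd_null_sqr]). The tool is
    the minimum of [<x, u^2> / <u, u>] over nonzero u, the least eigenvalue of x.

    Invariance. As B kills the unit, a maximum principle for the least eigenvalue
    ([flow_dual]) reduces the invariance of K under the flow to [<B z, f> >= 0] for z, f
    in K with [z f = 0]. Let [u_lm] be the scalar product of the entries of z and f at
    (l, m). The diagonal of [z f = 0] says that the rows of u have sum zero; this
    eliminates the off-diagonal entries of u, and with [s_l^2 = z_ll f_ll] and [c_l]
    equal to 1 or to [(n - 1)^2] there remains the inequality
    [sum_l c_l z_(l+1,l+1) f_ll >= n (n - 1) (s_1^2 - (n - 2) sum_(l > 1) s_l^2)]
    under the condition [s_1 <= sum_(l > 1) s_l]. It follows from the
    arithmetic-geometric inequality, which removes the cyclic shift, and from a bound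
    of a product by a variance ([prod_ge_variance], [cyclic_inequality]).

    No splitting. Suppose [B = A1 + A2] as in the statement, and pair with real
    matrices [v v^T] and [w w^T]. For orthogonal v, w the pairing of A2 vanishes, since
    [t |-> <exp (t A2) v v^T, w w^T>] has a minimum at 0 ([cone_g_orth]). So the
    quartic form of A1 is nonnegative everywhere and agrees with that of B on
    orthogonal pairs. Averaging over sign changes of the coordinates preserves both
    properties and removes most coefficients: with [u_i = v_i w_i], the average is
    the form of B plus [(sum u_i) (sum h_i u_i)] for some numbers [h_i]
    ([cyclic_form_splitting]). No choice of the [h_i] makes this nonnegative: the
    parameters p and q are such that the form of B has zeros with [sum u_i = 0],
    some of them only in the limit where the cyclic terms tend to their infimum,
    and the first-order conditions at these zeros are contradictory
    ([cyclic_form_rigid]). *)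

Set Implicit Arguments.
Unset Strict Implicit.
Unset Printing Implicit Defensive.

Import Order.TTheory GRing.Theory Num.Theory.
Import numFieldNormedType.Exports.

Local Open Scope classical_set_scope.
Local Open Scope ring_scope.

(** * Minima of Rayleigh quotients *)

Definition bilinear_form (R : realType) (V : vectType R) (q : V -> V -> R) :=
  (forall v, scalar (q v)) /\ (forall v, scalar (q^~ v)).

Section RayleighQuotient.
Variables (R : realType) (V : vectType R).
Implicit Types (q : V -> V -> R).

Lemma scalar0 (f : V -> R) : scalar f -> f 0 = 0.
Proof. by move=> fl; have := fl (-1) 0 0; rewrite scaler0 addr0 mulN1r addNr. Qed.

Lemma scalarD (f : V -> R) u v : scalar f -> f (u + v) = f u + f v.
Proof. by move=> fl; rewrite -[u]scale1r fl mul1r scale1r. Qed.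

Lemma scalarM (f : V -> R) a u : scalar f -> f (a *: u) = a * f u.
Proof. by move=> fl; rewrite -[a *: u]addr0 fl scalar0// addr0. Qed.

Lemma scalar_sum (f : V -> R) (I : finType) (r : I -> R) (e : I -> V) :
  scalar f -> f (\sum_i r i *: e i) = \sum_i r i * f (e i).
Proof.
move=> fl; elim/big_rec2: _ => [|i x y _ <-]; first exact: scalar0.
exact: fl.
Qed.

Let e := vbasis {:V}.
Let comb (r : 'rV[R]_(\dim {:V})) : V := \sum_i r ord0 i *: e`_i.

Lemma quadratic_continuous q : bilinear_form q ->
  continuous (fun r => q (comb r) (comb r) : R).
Proof.
move=> [ql qr].
have -> : (fun r => q (comb r) (comb r)) =
    (fun r : 'rV[R]_(\dim {:V}) => \sum_i \sum_j r ord0 i * (r ord0 j * q e`_i e`_j)).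
  apply/funext => r; rewrite /comb (@scalar_sum (q^~ _))//; apply: eq_bigr => i _.
  by rewrite scalar_sum// mulr_sumr.
apply: continuous_big; first exact: add_continuous.
move=> i _; apply: continuous_big; first exact: add_continuous.
move=> j _ r.
have cr k : continuous (fun s : 'rV[R]_(\dim {:V}) => s ord0 k : R).
  exact: coord_continuous.
exact: (cvgM (cr i r) (cvgM (cr j r) (@cvg_cst _ _ _ _ _))).
Qed.

(** The quotient is invariant under scaling of [u], so only the unit sphere of a
    coordinate space matters, and there a continuous function on a compact set has
    a minimum. The extra compact parameter [t] is a time: with a one-point set of
    times this is the least eigenvalue, with a segment it follows the least
    eigenvalue along a flow. The form depends on [t] through finitely many
    coefficients, so that no topology on [V] is involved. *)
Lemma rayleigh_min (T : topologicalType) (K : set T) (I : finType)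
    (x : I -> T -> R) (g : T -> R) (q : I -> V -> V -> R) (b : V -> V -> R) (v0 : V) :
  K !=set0 -> compact K -> (forall i, continuous (x i)) -> continuous g ->
  (forall i, bilinear_form (q i)) -> bilinear_form b ->
  (forall v, v != 0 -> 0 < b v v) -> v0 != 0 ->
  exists t0 y, [/\ K t0, y != 0 & forall t u, K t -> u != 0 ->
    g t0 + (\sum_i x i t0 * q i y y) / b y y
      <= g t + (\sum_i x i t * q i u u) / b u u].
Proof.
move=> K0 cK xc gc qb bb bpos v0n0.
pose S := [set r : 'rV[R]_(\dim {:V}) | `|r| = 1].
pose F (p : T * 'rV[R]_(\dim {:V})) : R :=
  g p.1 + (\sum_i x i p.1 * q i (comb p.2) (comb p.2)) / b (comb p.2) (comb p.2).
have comb_n0 r : r != 0 -> comb r != 0.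
  apply: contraNneq => r0; apply/eqP/rowP => i; rewrite mxE.
  have /freeP := basis_free (vbasisP {:V}).
  exact.
have combZ a r : comb (a *: r) = a *: comb r.
  by rewrite /comb scaler_sumr; apply: eq_bigr => i _; rewrite mxE scalerA.
have combK u : exists r, comb r = u.
  exists (\row_i coord e i u); rewrite [RHS](coord_vbasis (memvf u)).
  by apply: eq_bigr => i _; rewrite mxE.
have cS : compact S.
  apply: bounded_closed_compact.
    by exists 1; split; [exact: num_real|move=> M /ltW M1 r /= ->].
  rewrite (_ : S = Num.norm @^-1` [set 1]); last by [].
  apply: preimage_closed; last exact: closed_eq.
  by move=> r _; exact: norm_continuous.
have normalize u : u != 0 -> exists r a, [/\ S r, a != 0 & u = a *: comb r].
  have [r <-] := combK u => cr0.
  have r0 : r != 0.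
    apply: contraNneq cr0 => ->; rewrite /comb big1// => i _.
    by rewrite mxE scale0r.
  have nr0 : `|r| != 0 by rewrite normr_eq0.
  exists (`|r|^-1 *: r), `|r|; split => //.
    by rewrite /S/= normrZ normfV normr_id mulVf.
  by rewrite combZ scalerA mulfV// scale1r.
have S_n0 r : S r -> comb r != 0.
  move=> Sr; apply: comb_n0; rewrite -normr_eq0 Sr; exact: oner_neq0.
have Fc : {within K `*` S, continuous F}.
  apply: continuous_in_subspaceT => -[t r]; rewrite inE => -[/= Kt Sr].
  have c2 q' : bilinear_form q' ->
      {for (t, r), continuous (fun p : T * 'rV[R]_(\dim {:V}) =>
         q' (comb p.2) (comb p.2) : R)}.
    move=> bq; apply: (@continuous_comp _ _ _ snd (fun r => q' (comb r) (comb r))).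
      exact: cvg_snd.
    exact: quadratic_continuous.
  have c1 (f : T -> R) : continuous f ->
      {for (t, r), continuous (fun p : T * 'rV[R]_(\dim {:V}) => f p.1)}.
    move=> cf; apply: (@continuous_comp _ _ _ fst f); first exact: cvg_fst.
    exact: cf.
  apply: cvgD; first exact: c1.
  apply: cvgM.
    apply: cvg_big => [|i _]; first exact: add_continuous.
    by apply: cvgM; [exact: c1|exact: c2].
  apply: cvgV; last exact: c2.
  by rewrite /= gt_eqF// bpos// S_n0.
have KS0 : K `*` S !=set0.
  by have [t Kt] := K0; have [r [a [Sr _ _]]] := normalize _ v0n0; exists (t, r).
have [[t0 r0]] := compact_EVT_min KS0 (compact_setX cK cS) Fc.
rewrite inE => -[/= Kt0 Sr0] Fmin.
exists t0, (comb r0); split => //; first exact: S_n0.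
move=> t u Kt /normalize[r [a [Sr a0 ->]]].
have := Fmin (t, r); rewrite inE => /(_ (conj Kt Sr)).
rewrite /F /=; congr (_ <= _ + _).
have [bl br] := bb.
rewrite scalarM// (@scalarM (b^~ _))// mulrA -expr2.
have -> : \sum_i x i t * q i (a *: comb r) (a *: comb r) =
    a ^+ 2 * \sum_i x i t * q i (comb r) (comb r).
  rewrite mulr_sumr; apply: eq_bigr => i _; have [qil qir] := qb i.
  by rewrite scalarM// (@scalarM ((q i)^~ _))//; ring.
rewrite -mulf_div divff ?mul1r// expf_neq0//.
Qed.

End RayleighQuotient.

(** * Euclidean Jordan algebras: the cone of squares is self-dual *)

(** The unit is part of the structure because the spectral arguments below shift
    an element by multiples of it. *)
Record euclidean_jordan (R : realType) (V : vectType R) := EuclideanJordan {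
  jmul : V -> V -> V;
  jip : V -> V -> R;
  jone : V;
  jmulC : commutative jmul;
  jmul_linear : forall x, linear (jmul x);
  jipC : commutative jip;
  jip_scalar : forall x, scalar (jip x);
  jip_gt0 : forall x, x != 0 -> 0 < jip x x;
  jip_mul : forall x y z, jip (jmul x y) z = jip y (jmul x z);
  jmul1 : forall x, jmul jone x = x;
  jordan_identity : forall x y,
    jmul (jmul x x) (jmul x y) = jmul x (jmul (jmul x x) y) }.

Lemma affine_ge0_slope (R : realFieldType) (c d : R) :
  (forall s, 0 <= c + s * d) -> d = 0.
Proof.
move=> h; apply/eqP; apply: contraT => d0.
(* At this [s] the affine function takes the value -1. *)
have := h (- (c + 1) / d); rewrite divfK// => ?; lra.
Qed.

Section EuclideanJordanTheory.
Variables (R : realType) (V : vectType R) (J : euclidean_jordan V).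
Local Notation mul := (jmul J).
Local Notation ip := (jip J).
Local Notation e := (jone J).
Implicit Types (x y z u v : V) (W : {vspace V}).

HB.instance Definition _ x :=
  GRing.isLinear.Build R V V *:%R (jmul J x) (jmul_linear J x).

Lemma jmulDr x y z : mul x (y + z) = mul x y + mul x z.
Proof. exact: linearD. Qed.

Lemma jmulBr x y z : mul x (y - z) = mul x y - mul x z.
Proof. exact: linearB. Qed.

Lemma jmulZr a x y : mul x (a *: y) = a *: mul x y.
Proof. exact: linearZ. Qed.

Lemma jmulr0 x : mul x 0 = 0. Proof. exact: linear0. Qed.

Lemma jmulDl x y z : mul (x + y) z = mul x z + mul y z.
Proof. by rewrite ![mul _ z]jmulC jmulDr. Qed.

Lemma jmulBl x y z : mul (x - y) z = mul x z - mul y z.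
Proof. by rewrite ![mul _ z]jmulC jmulBr. Qed.

Lemma jmulZl a x y : mul (a *: x) y = a *: mul x y.
Proof. by rewrite ![mul _ y]jmulC jmulZr. Qed.

Lemma jmulr1 x : mul x e = x. Proof. by rewrite jmulC jmul1. Qed.

Lemma jipDr x y z : ip x (y + z) = ip x y + ip x z.
Proof. exact: scalarD (jip_scalar J x). Qed.

Lemma jipZr a x y : ip x (a *: y) = a * ip x y.
Proof. exact: scalarM (jip_scalar J x). Qed.

Lemma jip0r x : ip x 0 = 0. Proof. exact: scalar0 (jip_scalar J x). Qed.

Lemma jipDl x y z : ip (x + y) z = ip x z + ip y z.
Proof. by rewrite ![ip _ z]jipC jipDr. Qed.

Lemma jipZl a x y : ip (a *: x) y = a * ip x y.
Proof. by rewrite ![ip _ y]jipC jipZr. Qed.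

Lemma jipBl x y z : ip (x - y) z = ip x z - ip y z.
Proof. by rewrite -scaleN1r jipDl jipZl mulN1r. Qed.

Lemma jip_ge0 x : 0 <= ip x x.
Proof. by have [->|/(jip_gt0 J)/ltW//] := eqVneq x 0; rewrite jip0r. Qed.

Lemma jip_bilinear : bilinear_form ip.
Proof.
split=> v; first exact: jip_scalar.
by move=> a x y; rewrite jipDl jipZl.
Qed.

Lemma jip_eq0 W x : x \in W -> (forall u, u \in W -> ip x u = 0) -> x = 0.
Proof.
move=> xW x0; apply/eqP; apply: contraT => /(jip_gt0 J).
by rewrite x0// ltxx.
Qed.

Lemma jip_one_sqr u : ip e (mul u u) = ip u u.
Proof. by rewrite -jip_mul jmulr1. Qed.

Definition subalgebra W := forall u v, u \in W -> v \in W -> mul u v \in W.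

Lemma subalgebra_sqr W : (forall u, u \in W -> mul u u \in W) -> subalgebra W.
Proof.
move=> sqrW u v uW vW.
have -> : mul u v = 2^-1 *: (mul (u + v) (u + v) - mul u u - mul v v).
  rewrite jmulDr !jmulDl [mul v u]jmulC.
  apply: (@canRL _ _ _ _ (mul u v)  _ (scalerK _)); rewrite ?pnatr_eq0//.
  apply/eqP; rewrite eq_sym !subr_eq scaler_nat mulr2n; apply/eqP.
  by rewrite -!addrA addrC -!addrA.
by rewrite memvZ// !memvB// sqrW// memvD.
Qed.

Lemma subalgebraT : subalgebra {:V}.
Proof. by move=> u v _ _; exact: memvf. Qed.

(** The cone dual to the squares of [W]. Relativising to a subspace is what lets
    the induction on the dimension run inside subalgebras. *)
Definition dual_psd W z := forall u, u \in W -> 0 <= ip z (mul u u).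

(** The pair found here is the least eigenvalue of the form [<x, u^2>] with an
    eigenvector. It makes [x - l e] an element of the dual cone that annihilates a
    nonzero square. *)
Lemma dual_psd_min W x : W != 0%VS -> exists l y,
  [/\ y \in W, y != 0, ip x (mul y y) = l * ip y y
    & forall u, u \in W -> l * ip u u <= ip x (mul u u)].
Proof.
move=> W0.
pose q (_ : 'I_1) (u v : subvs_of W) : R := ip x (mul (vsval u) (vsval v)).
pose b (u v : subvs_of W) : R := ip (vsval u) (vsval v).
have vP a (u w : subvs_of W) : vsval (a *: u + w) = a *: vsval u + vsval w.
  by rewrite linearP.
have qb i : bilinear_form (q i).
  split=> v a u w; rewrite /q vP.
    by rewrite jmulDr jmulZr jipDr jipZr.
  by rewrite jmulDl jmulZl jipDr jipZr.
have bb : bilinear_form b.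
  split=> v a u w; rewrite /b vP.
    by rewrite jipDr jipZr.
  by rewrite jipDl jipZl.
have vs0 (u : subvs_of W) : (vsval u == 0) = (u == 0) by rewrite -val_eqE.
have bpos (v : subvs_of W) : v != 0 -> 0 < b v v.
  by rewrite -vs0; exact: jip_gt0.
have vp0 : Subvs (memv_pick W) != 0 by rewrite -vs0 /= vpick0.
have K0 : [set 0 : R] !=set0 by exists 0.
have cc (r : R) : continuous (cst r : R -> R) by move=> ?; exact: cvg_cst.
have [t0 [y [_ y0]]] := rayleigh_min K0 (@compact_set1 _ 0)
  (fun _ : 'I_1 => cc 1) (cc 0) qb bb bpos vp0.
rewrite big_ord1 /= mul1r add0r => ymin.
exists (q ord0 y y / b y y), (vsval y); split; rewrite ?subvsP ?vs0//.
  by rewrite divfK// gt_eqF// bpos.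
move=> u uW; have [->|u0] := eqVneq u 0; first by rewrite jmulr0 !jip0r mulr0.
have := ymin 0 (Subvs uW) erefl; rewrite big_ord1 /= mul1r add0r -vs0 => /(_ u0).
by rewrite ler_pdivlMr ?bpos// -vs0.
Qed.

(** A zero of a nonnegative quadratic form is a critical point: the form
    [<z, (u + s y)^2>] is nonnegative and affine in [s]. *)
Lemma dual_psd_orth W z y : subalgebra W -> dual_psd W z -> z \in W -> y \in W ->
  ip z (mul y y) = 0 -> mul z y = 0.
Proof.
move=> subW psdz zW yW zy0; apply: (@jip_eq0 W); first exact: subW.
move=> u uW; rewrite [mul z y]jmulC jip_mul.
suff : 2 * ip z (mul y u) = 0 by move/eqP; rewrite mulf_eq0 pnatr_eq0 /= => /eqP.
apply: (@affine_ge0_slope _ (ip z (mul u u))) => s.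
have := psdz (u + s *: y); rewrite memvD ?memvZ// => /(_ isT).
rewrite jmulDr !jmulDl !jmulZr !jmulZl !jipDr !jipZr zy0.
by rewrite [mul u y]jmulC; lra.
Qed.

Definition jnull z W : {vspace V} := (W :&: lker (linfun (mul z)))%VS.

Lemma mem_jnull z W u : (u \in jnull z W) = (u \in W) && (mul z u == 0).
Proof. by rewrite memv_cap memv_ker lfunE. Qed.

(** By the Jordan identity [y (y^2 z) = y^2 (y z) = 0], hence
    [<z, (y^2)^2> = 0] and [y^2] is again a zero of the form of [z]. *)
Lemma dual_psd_null_sqr W z y : subalgebra W -> dual_psd W z -> z \in W ->
  y \in W -> mul z y = 0 -> mul z (mul y y) = 0.
Proof.
move=> subW psdz zW yW zy0; apply: (dual_psd_orth subW) => //; first exact: subW.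
have yyz : mul y (mul (mul y y) z) = 0.
  by rewrite -(jordan_identity J) [mul y z]jmulC zy0 jmulr0.
by rewrite -2!jip_mul yyz jipC jip0r.
Qed.

(** Polarisation reduces closure under products to closure under squares. *)
Lemma jnull_subalgebra W z : subalgebra W -> dual_psd W z -> z \in W ->
  subalgebra (jnull z W).
Proof.
move=> subW psdz zW; apply: subalgebra_sqr => u; rewrite !mem_jnull.
by move=> /andP[uW /eqP zu0]; rewrite subW//= (dual_psd_null_sqr subW psdz).
Qed.

(** The orthogonal projection [c] of [e] on [W] is a unit of [W], because
    [<c u, v> = <c, u v> = <e, u v> = <u, v>]. The second property of [c] is the
    way this projection is used later on. *)
Lemma subalgebra_unit W : subalgebra W -> exists c,
  [/\ c \in W, forall u, u \in W -> mul c u = u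
    & forall u, u \in W -> ip c u = ip e u].
Proof.
move=> subW; set X := vbasis W.
(* The Gram operator of a basis of [W]: injective on [W] and with values in
   [W], it maps [W] onto itself. The preimage of [f e] is the projection. *)
pose f v := \sum_(i < \dim W) ip v X`_i *: X`_i.
have lf : linear f.
  move=> a u v; rewrite /f scaler_sumr -big_split; apply: eq_bigr => i _.
  by rewrite jipDl jipZl scalerDl scalerA.
pose F := linfun (HB.pack f (GRing.isLinear.Build R V V *:%R f lf) : {linear V -> V}).
have FE v : F v = f v by rewrite lfunE.
have XW (i : 'I_(\dim W)) : X`_i \in W.
  by rewrite vbasis_mem// mem_nth// size_tuple.
have fW v : f v \in W by rewrite memv_suml// => i _; rewrite memvZ.
have ipX c d : (forall i : 'I_(\dim W), ip c X`_i = ip d X`_i) ->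
    forall u, u \in W -> ip c u = ip d u.
  move=> cd u uW; rewrite (coord_vbasis uW) !scalar_sum; try exact: jip_scalar.
  by apply: eq_bigr => i _; rewrite cd.
have freeX k : \sum_(i < \dim W) k i *: X`_i = 0 -> forall i, k i = 0.
  by have /freeP := basis_free (vbasisP W); exact.
have FW : (F @: W)%VS = W.
  apply/eqP; rewrite eqEdim; apply/andP; split.
    by apply/subvP => _ /memv_imgP[v _ ->]; rewrite FE.
  rewrite limg_dim_eq//; apply/eqP; rewrite -subv0; apply/subvP => v.
  rewrite memv_cap memv_ker FE memv0 => /andP[vW /eqP/freeX v0].
  apply/eqP; apply: (jip_eq0 vW) => u uW.
  rewrite (ipX v 0)// => [|i]; first by rewrite jipC jip0r.
  by rewrite v0 jipC jip0r.
have : f e \in (F @: W)%VS by rewrite FW.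
move=> /memv_imgP[c cW]; rewrite FE => /eqP; rewrite -subr_eq0 -sumrB => /eqP fec.
have ce u : u \in W -> ip c u = ip e u.
  apply: ipX => i; apply/esym/eqP; rewrite -subr_eq0; apply/eqP.
  apply: (freeX (fun i => ip e X`_i - ip c X`_i)); rewrite -[RHS]fec.
  by apply: eq_bigr => j _; rewrite scalerBl.
exists c; split => // u uW.
apply/eqP; rewrite -subr_eq0; apply/eqP; apply: (@jip_eq0 W).
  by rewrite memvB// subW.
move=> v vW; rewrite jipBl jmulC jip_mul ce ?subW//.
by rewrite -jip_mul jmulr1 subrr.
Qed.

(** Squares belong to the dual cone. Otherwise the least eigenvalue [l] of the
    form of [x^2] is negative. Let [c] be the unit of the null algebra of
    [z = x^2 - l e]. Then [x^2 c = l c], and by the Jordan identity [x c] is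
    killed by [z] as well, so that [<x^2, c> = <x c, x c> >= 0], whereas
    [<x^2, c> = l <c, c> < 0]. *)
Lemma ip_sqr_sqr x u : 0 <= ip (mul x x) (mul u u).
Proof.
rewrite leNgt; apply/negP => xu0.
have V0 : {:V}%VS != 0%VS.
  apply: contraTneq xu0 => V0; have : u \in {:V}%VS by exact: memvf.
  by rewrite V0 memv0 => /eqP ->; rewrite jmulr0 jip0r ltxx.
have [l [y [_ y0 yl lmin]]] := dual_psd_min (mul x x) V0.
have l0 : l < 0.
  rewrite ltNge; apply/negP => l0; have := lmin u (memvf u).
  by rewrite leNgt (lt_le_trans xu0)// mulr_ge0// jip_ge0.
(* Shifting by the least eigenvalue produces an element of the dual cone. *)
pose z := mul x x - l *: e.
have psdz : dual_psd {:V} z.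
  by move=> v _; rewrite jipBl jipZl jip_one_sqr subr_ge0 lmin// memvf.
have zy0 : mul z y = 0.
  apply: (dual_psd_orth subalgebraT psdz); rewrite ?memvf//.
  by rewrite jipBl jipZl jip_one_sqr yl subrr.
have [c [cN cunit cone]] := subalgebra_unit (jnull_subalgebra subalgebraT psdz (memvf z)).
have yN : y \in jnull z {:V} by rewrite mem_jnull memvf zy0 eqxx.
have zc0 : mul z c = 0 by move: cN; rewrite mem_jnull => /andP[_ /eqP].
have xxc : mul (mul x x) c = l *: c.
  by apply/eqP; rewrite -subr_eq0 -[X in _ - l *: X](jmul1 J) -jmulZl -jmulBl zc0.
pose g := mul x c.
have gN : g \in jnull z {:V}.
  rewrite mem_jnull memvf /= /z jmulBl jmulZl jmul1 jordan_identity xxc jmulZr.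
  by rewrite subrr.
have c0 : c != 0.
  by apply: contraNneq y0 => c0; rewrite -(cunit y yN) c0 jmulC jmulr0.
have : 0 <= ip (mul x x) c.
  by rewrite jip_mul -/g -(cunit g gN) -jip_mul [mul c x]jmulC jip_ge0.
rewrite -[mul x x]jmulr1 jip_mul xxc jipZr -cone// leNgt nmulr_rlt0//.
by rewrite jip_gt0.
Qed.

(** The spectral decomposition, one eigenvalue at a time: with [l] the least
    eigenvalue of [x] and [c] the idempotent of its null algebra, [x - l c] lives
    in the smaller subalgebra annihilated by [c], where it is a square by
    induction; the two square roots multiply to zero. *)
Lemma dual_psd_square W x : subalgebra W -> x \in W -> dual_psd W x ->
  exists2 s, s \in W & x = mul s s.
Proof.
have [k] := ubnP (\dim W); elim: k W x => // k IH W x dimW subW xW psdx.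
have [W0|W0] := eqVneq W 0%VS.
  exists 0; rewrite ?mem0v// jmulr0; apply/eqP.
  by move: xW; rewrite W0 memv0.
have [l [y [yW y0 yl lmin]]] := dual_psd_min x W0.
have l0 : 0 <= l.
  by rewrite -(@pmulr_lge0 _ (ip y y)) ?jip_gt0// -yl psdx.
have [eW [eWW eWunit eWone]] := subalgebra_unit subW.
have eW_sqr u : u \in W -> ip eW (mul u u) = ip u u.
  by move=> uW; rewrite eWone ?jip_one_sqr// subW.
pose z := x - l *: eW.
have zW : z \in W by rewrite memvB// memvZ.
have psdz : dual_psd W z.
  by move=> u uW; rewrite jipBl jipZl eW_sqr// subr_ge0 lmin.
have zy0 : mul z y = 0.
  by apply: (dual_psd_orth subW psdz) => //; rewrite jipBl jipZl eW_sqr// yl subrr.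
have [c [cN cunit cone]] := subalgebra_unit (jnull_subalgebra subW psdz zW).
have yN : y \in jnull z W by rewrite mem_jnull yW zy0 eqxx.
have [cW zc0] : c \in W /\ mul z c = 0.
  by move: cN; rewrite mem_jnull => /andP[? /eqP].
have cc : mul c c = c by exact: cunit.
have c0 : c != 0.
  by apply: contraNneq y0 => c0; rewrite -(cunit y yN) c0 jmulC jmulr0.
have psdc : dual_psd W c by move=> u _; rewrite -cc ip_sqr_sqr.
have subW' := jnull_subalgebra subW psdc cW.
pose x' := z + l *: (eW - c).
have xE : x = x' + l *: c.
  by rewrite /x' /z -addrA -scalerDr subrK subrK.
have x'W' : x' \in jnull c W.
  have x'W : x' \in W by rewrite memvD// memvZ// memvB.
  rewrite mem_jnull x'W /= /x' jmulDr [mul c z]jmulC zc0 add0r.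
  by rewrite jmulZr jmulBr cc [mul c eW]jmulC eWunit// subrr scaler0.
have psdx' : dual_psd (jnull c W) x'.
  move=> u; rewrite mem_jnull => /andP[uW /eqP cu0].
  have := psdx u uW; rewrite xE jipDl jipZl.
  by rewrite -[ip c _]jip_mul [mul u c]jmulC cu0 [ip 0 u]jipC jip0r mulr0 addr0.
have dimW' : (\dim (jnull c W) < k)%N.
  rewrite -ltnS; apply: leq_trans dimW; rewrite ltnS ltn_neqAle dimvS ?capvSl// andbT.
  apply: contraNneq c0 => dimE.
  have /eqP W'E : jnull c W == W by rewrite eqEdim capvSl dimE leqnn.
  by move: cW; rewrite -W'E mem_jnull cc => /andP[_].
have [s] := IH _ _ dimW' subW' x'W' psdx'.
rewrite mem_jnull => /andP[sW /eqP cs0] x'E.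
exists (Num.sqrt l *: c + s); first by rewrite memvD ?memvZ.
rewrite xE x'E jmulDr !jmulDl !jmulZr !jmulZl cc [mul s c]jmulC cs0.
by rewrite !scaler0 addr0 add0r scalerA -expr2 sqr_sqrtr// addrC.
Qed.

End EuclideanJordanTheory.

(** * The exponential of a linear map *)

Section LinearExponential.
Variable R : realType.

(** The operator norm of [T] for the sum norm of the coordinates bounds the
    powers; it is phrased for a single linear form so that only real series occur
    below. *)
Lemma iter_growth (W : vectType R) (T : 'End(W)) (phi : W -> R) (w : W) :
  scalar phi -> exists C M, [/\ 0 <= C, 0 <= M
    & forall j, `|phi (iter j T w)| <= C * M ^+ j].
Proof.
move=> phil; set e := vbasis {:W}.
pose N (v : W) : R := \sum_i `|coord e i v|.
pose M : R := \sum_i \sum_(j < \dim {:W}) `|coord e i (T e`_j)|.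
pose C : R := \sum_(i < \dim {:W}) `|phi e`_i|.
have N0 v : 0 <= N v by exact: sumr_ge0.
have M0 : 0 <= M by apply: sumr_ge0 => i _; exact: sumr_ge0.
have bound (f : W -> R) v : scalar f -> `|f v| <= N v * \sum_(j < \dim {:W}) `|f e`_j|.
  move=> fl; rewrite {1}(coord_vbasis (memvf v)) scalar_sum//.
  apply: le_trans (ler_norm_sum _ _ _) _; rewrite mulr_sumr ler_sum// => i _.
  rewrite normrM ler_wpM2r// /N (bigD1 i)//= lerDl; exact: sumr_ge0.
have NT v : N (T v) <= M * N v.
  rewrite mulrC /N /M mulr_sumr ler_sum// => i _.
  apply: (bound (fun v => coord e i (T v))) => a x y.
  by rewrite !linearP.
have NTj j : N (iter j T w) <= M ^+ j * N w.
  elim: j => [|j IH]; first by rewrite mul1r.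
  by rewrite iterS exprS -mulrA; apply: le_trans (NT _) _; rewrite ler_wpM2l.
exists (C * N w), M; split; rewrite ?mulr_ge0//; first exact: sumr_ge0.
move=> j; apply: le_trans (bound _ _ phil) _; rewrite -/C mulrC -mulrA ler_wpM2l//.
  exact: sumr_ge0.
by rewrite mulrC.
Qed.

Section Exponential.
Variables (V : vectType R) (A : 'End(V)).
Local Notation pow j := (iter j (comp_lfun A) \1%VF).

(** Coefficients of the power series [t |-> phi (exp (t A))]. The exponential is
    studied through the linear forms on it: this turns every statement about a
    limit of linear maps into one about a real power series. *)
Definition exp_coef (phi : 'End(V) -> R) (j : nat) : R := (j`!%:R)^-1 * phi (pow j).

(** Comparison with the real exponential series. The powers of [A] are the orbit
    of the identity under left composition by [A], to which the growth bound
    applies. *)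
Lemma exp_coef_cvg phi t : scalar phi -> cvgn (pseries (exp_coef phi) t).
Proof.
move=> phil.
have Tl : linear (comp_lfun A : 'End(V) -> 'End(V)).
  by move=> a X Y; rewrite comp_lfunDr comp_lfunZr.
pose T : 'End('End(V)) := linfun
  (HB.pack (comp_lfun A : 'End(V) -> 'End(V))
     (GRing.isLinear.Build R _ _ *:%R (comp_lfun A : 'End(V) -> 'End(V)) Tl)
   : {linear 'End(V) -> 'End(V)}).
have [C [M [C0 M0 growth]]] := iter_growth T \1%VF phil.
have powE j : pow j = iter j T \1%VF.
  by elim: j => //= j ->; rewrite lfunE.
apply: normed_cvg.
apply: (@series_le_cvg _ _ (fun j => C * exp_coeff (M * `|t|) j)).
- by move=> j; exact: normr_ge0.
- by move=> j; rewrite mulr_ge0// exp_coeff_ge0// mulr_ge0.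
- move=> j; rewrite /= /exp_coef powE !normrM normfV normrX exp_coeffE /= exprMn.
  rewrite [`|_%:R|]ger0_norm//.
  rewrite [leRHS](_ : _ = (j`!%:R)^-1 * (C * M ^+ j) * `|t| ^+ j); last by ring.
  by rewrite ler_wpM2r ?exprn_ge0// ler_wpM2l ?invr_ge0.
- apply: is_cvg_seriesZ; exact: is_cvg_series_exp_coeff.
Qed.

(** A linear form commutes with coordinatewise limits, being a finite linear
    combination of coordinates. *)
Lemma vlim_scalar (W : vectType R) (u : nat -> W) (psi : W -> R) : scalar psi ->
  (forall i : 'I_(\dim {:W}), cvgn (fun N => coord (vbasis {:W}) i (u N))) ->
  psi (vlim u) = limn (fun N => psi (u N)).
Proof.
move=> psil cu; rewrite /vlim scalar_sum//; apply/esym/cvg_lim => //.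
rewrite (_ : (fun N => psi (u N)) = fun N =>
    \sum_(i < \dim {:W}) coord (vbasis {:W}) i (u N) * psi (vbasis {:W})`_i).
  apply: cvg_big => [|i _]; first exact: add_continuous.
  by apply: cvgM; [exact: cu|exact: cvg_cst].
by apply/funext => N; rewrite {1}(coord_vbasis (memvf (u N))) scalar_sum.
Qed.

Lemma lexp_scalar (phi : 'End(V) -> R) t : scalar phi ->
  phi (lexp (t *: A)) = limn (pseries (exp_coef phi) t).
Proof.
move=> phil.
have powZ j : iter j (comp_lfun (t *: A)) \1%VF = t ^+ j *: pow j.
  elim: j => [|j IH] /=; first by rewrite scale1r.
  by rewrite IH -comp_lfunZl -comp_lfunZr scalerA -exprS.
have partial (psi : 'End(V) -> R) : scalar psi ->
    (fun N => psi (\sum_(j < N) (j`!%:R)^-1 *: iter j (comp_lfun (t *: A)) \1%VF))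
    = pseries (exp_coef psi) t.
  move=> psil; apply/funext => N; rewrite scalar_sum// /pseries /series /= big_mkord.
  by apply: eq_bigr => j _; rewrite powZ scalarM// /exp_coef; ring.
rewrite /lexp vlim_scalar//; first by rewrite partial.
move=> i.
have ci : scalar (coord (vbasis {:'End(V)}) i : 'End(V) -> R).
  by move=> a x y; rewrite linearP.
by rewrite (partial _ ci); exact: exp_coef_cvg.
Qed.

Lemma comp_scalar (phi : 'End(V) -> R) : scalar phi -> scalar (fun X => phi (A \o X)%VF).
Proof. by move=> phil a X Y; rewrite comp_lfunDr -comp_lfunZr phil. Qed.

(** Termwise differentiation of a power series; the shifted coefficients are
    those of the form [X |-> phi (A X)]. *)
Lemma lexp_derive (phi : 'End(V) -> R) t : scalar phi ->
  is_derive t (1 : R) (fun s : R => phi (lexp (s *: A))) (phi (A \o lexp (t *: A))%VF).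
Proof.
move=> phil.
have diffs (psi : 'End(V) -> R) :
    pseries_diffs (exp_coef psi) = exp_coef (fun X => psi (A \o X)%VF).
  apply/funext => j; rewrite /pseries_diffs /exp_coef factS natrM invfM mulrA mulrA.
  by rewrite mulfV// mul1r.
have phi1 := comp_scalar phil; have phi2 := comp_scalar phi1.
rewrite (lexp_scalar t phi1) -diffs.
rewrite (_ : (fun s : R => _) = fun s => limn (pseries (exp_coef phi) s)); last first.
  by apply/funext => s; rewrite lexp_scalar.
apply: (@pseries_snd_diffs _ _ (`|t| + 1)); rewrite ?diffs; try exact: exp_coef_cvg.
by rewrite [ltRHS]ger0_norm ?addr_ge0// ltrDl.
Qed.

Lemma lexp0 (phi : 'End(V) -> R) : scalar phi -> phi (lexp (0 *: A)) = phi \1%VF.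
Proof.
move=> phil; rewrite lexp_scalar//; apply: cvg_lim => //.
rewrite -(cvg_shiftS) /=.
rewrite (_ : (fun n => _) = fun=> phi \1%VF); first exact: cvg_cst.
apply/funext => N; rewrite /pseries /series /= big_nat_recl//= /exp_coef fact0.
rewrite expr0 mulr1 invr1 mul1r big1 ?addr0// => i _.
by rewrite exprS mul0r mulr0.
Qed.

End Exponential.
End LinearExponential.

(** * Flows that preserve the cone of squares *)

(** The minimum is only one-sided: [t] may be the right end of the interval, so
    only difference quotients from the left are available and the derivative need
    not vanish. *)
Lemma derive_le0_at_left_min (R : realType) (f : R -> R) (a t d : R) :
  is_derive t (1 : R) f d -> a < t -> (forall s, a <= s <= t -> f t <= f s) -> d <= 0.
Proof.
move=> df at_ fmin; rewrite leNgt; apply/negP => d0.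
have cv : h^-1 *: ((f \o shift t) (h *: (1 : R)) - f t) @[h --> (0 : R)^'] --> d.
  have [df1 <-] := df; exact: df1.
have /cvgr_gt/(_ _ d0) quot := cvg_dnbhs_at_left cv.
near (0 : R)^'- => h.
have h0 : h < 0 by near: h; exact: nbhs_left_lt.
have ha : a - t < h by near: h; apply: nbhs_left_gt; rewrite subr_lt0.
have : 0 < h^-1 *: ((f \o shift t) (h *: (1 : R)) - f t) by near: h; exact: quot.
rewrite /= -[h *: 1]/(h * 1) mulr1 -[_ *: _]/(_ * _) nmulr_rgt0 ?invr_lt0// subr_lt0.
rewrite ltNge fmin//; apply/andP; split; lra.
Unshelve. all: by end_near.
Qed.

Section PositiveFlow.
Variables (R : realType) (V : vectType R) (J : euclidean_jordan V) (B : 'End(V)).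
Local Notation mul := (jmul J).
Local Notation ip := (jip J).
Local Notation dual := (dual_psd J {:V}).

Lemma apply_scalar (phi : V -> R) x : scalar phi -> scalar (fun A : 'End(V) => phi (A x)).
Proof. by move=> phil a A1 A2; rewrite add_lfunE scale_lfunE phil. Qed.

Hypothesis B1 : B (jone J) = 0.
Hypothesis B_cross : forall z y, dual z -> mul z (mul y y) = 0 ->
  0 <= ip (B z) (mul y y).

(** The maximum principle. At a minimum [(s0, y)] over the segment of times and the
    nonzero vectors, let [l] be the value of the Rayleigh quotient and
    [z = exp (s0 B) x - l e]. Then [z] belongs to the dual cone and annihilates [y],
    hence [y^2]; since [B e = 0], cross-positivity says that the quotient has a
    nonnegative time derivative at [s0]. The penalty [eps t] makes the total
    derivative positive, which is impossible at a minimum with [s0 > 0]. So the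
    minimum is attained at time zero, where it is nonnegative. *)
Lemma flow_penalized x (t eps : R) u : 0 <= t -> 0 < eps -> dual x -> u != 0 ->
  0 <= eps * t + ip (lexp (t *: B) x) (mul u u) / ip u u.
Proof.
move=> t0 eps0 psdx u0.
pose e := vbasis {:V}.
pose xi (i : 'I_(\dim {:V})) (s : R) : R := coord e i (lexp (s *: B) x).
pose q (i : 'I_(\dim {:V})) (v w : V) := ip e`_i (mul v w).
have coord_s i : scalar (coord e i : V -> R) by move=> a v w; rewrite linearP.
have ip_s w : scalar (ip^~ w) := (jip_bilinear J).2 w.
have dxi (phi : V -> R) s : scalar phi -> is_derive s (1 : R)
    (fun s => phi (lexp (s *: B) x)) (phi (B (lexp (s *: B) x))).
  by move=> phil; rewrite -[B (_ x)]comp_lfunE; exact: lexp_derive (apply_scalar x phil).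
have cxi i : continuous (xi i).
  move=> s; apply/differentiable_continuous/derivable1_diffP.
  by case: (dxi _ s (coord_s i)).
have ceps : continuous (fun s : R => eps * s) by move=> s; exact: mulrl_continuous.
have qb i : bilinear_form (q i).
  split=> w a v1 v2; first by rewrite /q jmulDr jmulZr jipDr jipZr.
  by rewrite /q jmulDl jmulZl jipDr jipZr.
have sumE s w : \sum_i xi i s * q i w w = ip (lexp (s *: B) x) (mul w w).
  rewrite [in RHS](coord_vbasis (memvf (lexp (s *: B) x))).
  by rewrite (@scalar_sum _ _ (ip^~ (mul w w))).
have K0 : `[0, t]%classic !=set0 by exists 0; rewrite /= in_itv /= lexx.
have [s0 [y [+ y0 ymin]]] := rayleigh_min K0 (@segment_compact _ 0 t) cxi ceps qb
  (jip_bilinear J) (@jip_gt0 _ _ J) u0.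
rewrite /= in_itv /= => /andP[s0_ge0 s0t].
have {}ymin s w : 0 <= s <= t -> w != 0 ->
    eps * s0 + ip (lexp (s0 *: B) x) (mul y y) / ip y y
      <= eps * s + ip (lexp (s *: B) x) (mul w w) / ip w w.
  by move=> st w0; have := ymin s w; rewrite /= in_itv /= !sumE; exact.
have yy0 : 0 < ip y y by exact: jip_gt0.
suff min_ge0 : 0 <= eps * s0 + ip (lexp (s0 *: B) x) (mul y y) / ip y y.
  by apply: le_trans min_ge0 (ymin t u _ u0); rewrite t0 lexx.
have [s0_eq0|s0_neq0] := eqVneq s0 0.
  rewrite s0_eq0 mulr0 add0r divr_ge0 ?(ltW yy0)//.
  rewrite (lexp0 B (apply_scalar x (ip_s (mul y y)))) id_lfunE.
  exact: psdx y (memvf y).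
have s0_gt0 : 0 < s0 by rewrite lt_def s0_neq0.
exfalso.
pose l := ip (lexp (s0 *: B) x) (mul y y) / ip y y.
pose z := lexp (s0 *: B) x - l *: jone J.
have psdz : dual z.
  move=> w _; have [->|w0] := eqVneq w 0; first by rewrite jmulr0 jip0r.
  rewrite jipBl jipZl jip_one_sqr subr_ge0 -ler_pdivlMr ?jip_gt0//.
  by have := ymin s0 w; rewrite s0_ge0 s0t lerD2l => /(_ isT); exact.
have zy0 : mul z y = 0.
  apply: (dual_psd_orth (subalgebraT J) psdz); rewrite ?memvf//.
  by rewrite jipBl jipZl jip_one_sqr /l divfK ?subrr// gt_eqF.
have := B_cross psdz (dual_psd_null_sqr (subalgebraT J) psdz (memvf z) (memvf y) zy0).
rewrite /z linearB linearZ /= B1 scaler0 subr0 leNgt => /negP; apply.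
pose phi v := (ip y y)^-1 * ip v (mul y y).
have phil : scalar phi by move=> a v w; rewrite /phi ip_s; ring.
pose h s := eps * s + phi (lexp (s *: B) x).
have dh : is_derive s0 (1 : R) h (eps + phi (B (lexp (s0 *: B) x))).
  have deps : is_derive s0 (1 : R) (fun s : R => eps * s) eps.
    by apply: is_derive_eq (is_deriveZ eps (is_derive_id s0 (1 : R))) _; exact: mulr1.
  exact: is_deriveD deps (dxi phi s0 phil).
have hmin s : 0 <= s <= s0 -> h s0 <= h s.
  move=> /andP[s_ge0 ss0]; rewrite /h /phi ![(ip y y)^-1 * _]mulrC ymin//.
  by rewrite s_ge0 (le_trans ss0).
have hle := derive_le0_at_left_min dh s0_gt0 hmin.
have : phi (B (lexp (s0 *: B) x)) < 0 by lra.
by rewrite /phi pmulr_rlt0 ?invr_gt0.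
Qed.

(** Let the penalty tend to zero. *)
Lemma flow_dual x t : 0 <= t -> dual x -> dual (lexp (t *: B) x).
Proof.
move=> t0 psdx u _; have [->|u0] := eqVneq u 0; first by rewrite jmulr0 jip0r.
rewrite -(@pmulr_lge0 _ (ip u u)^-1) ?invr_gt0 ?jip_gt0//.
apply/ler_addgt0Pr => e e0.
have t1 : 0 < t + 1 by lra.
have := flow_penalized t0 (divr_gt0 e0 t1) psdx u0.
have : e / (t + 1) * t <= e by rewrite mulrAC ler_pdivrMr//; nra.
lra.
Qed.

End PositiveFlow.

(** * Cayley-Dickson algebras *)

Section CayleyDickson.
Variable R : realType.

Fixpoint cd_one k : cayley_dickson R k :=
  match k with
  | 0%N => (1 : R)
  | k'.+1 => (cd_one k', 0)
  end.

Fixpoint cd_ip k : cayley_dickson R k -> cayley_dickson R k -> R :=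
  match k with
  | 0%N => fun x y : R => x * y
  | k'.+1 => fun x y => cd_ip x.1 y.1 + cd_ip x.2 y.2
  end.

(** Both sides have to be proved at once: the doubled product permutes the factors. *)
Lemma cd_mul_bilinear k :
  (forall y : cayley_dickson R k, linear (@cd_mul R k ^~ y)) /\
  (forall x : cayley_dickson R k, linear (@cd_mul R k x)).
Proof.
elim: k => [|k [IHl IHr]] /=.
  by split=> y a x z; rewrite /= -![_ *: _]/(_ * _); ring.
have comb a (p q r s : cayley_dickson R k) :
    a *: p + q - (a *: r + s) = a *: (p - r) + (q - s).
  by rewrite opprD addrACA scalerBr.
have combD a (p q r s : cayley_dickson R k) :
    a *: p + q + (a *: r + s) = a *: (p + r) + (q + s).
  by rewrite addrACA scalerDr.
have IHl' (y : cayley_dickson R k) a x z :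
    cd_mul (a *: x + z) y = a *: cd_mul x y + cd_mul z y := IHl y a x z.
by split=> y a x z /=; rewrite ?linearP ?IHr ?IHl' ?comb ?combD.
Qed.

Section Level.
Variable k : nat.
Implicit Types x y z w : cayley_dickson R k.

HB.instance Definition _ x := GRing.isLinear.Build R (cayley_dickson R k)
  (cayley_dickson R k) *:%R (cd_mul x) ((cd_mul_bilinear k).2 x).

Lemma cd_mulDl x y z : cd_mul (x + y) z = cd_mul x z + cd_mul y z.
Proof. by have := (cd_mul_bilinear k).1 z 1 x y; rewrite !scale1r. Qed.

Lemma cd_mul0l z : cd_mul 0 z = 0.
Proof. by have := (cd_mul_bilinear k).1 z (-1) 0 0; rewrite scaler0 addr0 scaleN1r addNr. Qed.

Lemma cd_mulZl a x z : cd_mul (a *: x) z = a *: cd_mul x z.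
Proof. by have := (cd_mul_bilinear k).1 z a x 0; rewrite cd_mul0l !addr0. Qed.

Lemma cd_mulNl x z : cd_mul (- x) z = - cd_mul x z.
Proof. by rewrite -scaleN1r cd_mulZl scaleN1r. Qed.

Lemma cd_mulBl x y z : cd_mul (x - y) z = cd_mul x z - cd_mul y z.
Proof. by rewrite cd_mulDl cd_mulNl. Qed.

Lemma cd_mulDr x y z : cd_mul x (y + z) = cd_mul x y + cd_mul x z.
Proof. exact: linearD. Qed.

Lemma cd_mulBr x y z : cd_mul x (y - z) = cd_mul x y - cd_mul x z.
Proof. exact: linearB. Qed.

Lemma cd_mulNr x y : cd_mul x (- y) = - cd_mul x y.
Proof. exact: linearN. Qed.

Lemma cd_mulZr a x y : cd_mul x (a *: y) = a *: cd_mul x y.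
Proof. exact: linearZ. Qed.

Lemma cd_mul0r x : cd_mul x 0 = 0. Proof. exact: linear0. Qed.

End Level.

Lemma cd_ip_bilinear k : bilinear_form (@cd_ip k).
Proof.
elim: k => [|k [IHl IHr]].
  by split=> v a x y; rewrite /= -[a *: x]/(a * x); ring.
split=> v a x y /=.
  by rewrite !IHl mulrDr addrACA.
by have IHr' w b p q : cd_ip (b *: p + q) w = b * cd_ip p w + cd_ip q w := IHr w b p q;
  rewrite !IHr' mulrDr addrACA.
Qed.

Lemma cd_ipC k : commutative (@cd_ip k).
Proof.
elim: k => [|k IH] x y /=; first by rewrite mulrC.
by rewrite ![cd_ip x.1 _]IH [cd_ip x.2 _]IH.
Qed.

Lemma cd_ip_gt0 k (x : cayley_dickson R k) : x != 0 -> 0 < cd_ip x x.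
Proof.
have ip_ge0 j (y : cayley_dickson R j) : 0 <= cd_ip y y.
  by elim: j y => [|j IH] y /=; [rewrite -expr2 sqr_ge0|rewrite addr_ge0].
elim: k x => [|k IH] x /= x0; first by rewrite -expr2 exprn_even_gt0.
have [x10|x10] := eqVneq x.1 0; last by rewrite ltr_pwDl ?IH.
rewrite ltr_pwDr// IH//; apply: contraNneq x0 => x20.
by rewrite [x]surjective_pairing x10 x20.
Qed.

Lemma cd_ip_scalar k (x : cayley_dickson R k) : scalar (cd_ip x).
Proof. exact: (cd_ip_bilinear k).1. Qed.

Section InnerProduct.
Variable k : nat.
Implicit Types x y z w : cayley_dickson R k.

Lemma cd_ipDr x y z : cd_ip x (y + z) = cd_ip x y + cd_ip x z.
Proof. exact: scalarD (cd_ip_scalar x). Qed.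

Lemma cd_ipZr a x y : cd_ip x (a *: y) = a * cd_ip x y.
Proof. exact: scalarM (cd_ip_scalar x). Qed.

Lemma cd_ip0r x : cd_ip x 0 = 0.
Proof. exact: scalar0 (cd_ip_scalar x). Qed.

Lemma cd_ipNr x y : cd_ip x (- y) = - cd_ip x y.
Proof. by rewrite -scaleN1r cd_ipZr mulN1r. Qed.

Lemma cd_ipBr x y z : cd_ip x (y - z) = cd_ip x y - cd_ip x z.
Proof. by rewrite cd_ipDr cd_ipNr. Qed.

Lemma cd_ipDl x y z : cd_ip (x + y) z = cd_ip x z + cd_ip y z.
Proof. by rewrite ![cd_ip _ z]cd_ipC cd_ipDr. Qed.

Lemma cd_ipNl x y : cd_ip (- x) y = - cd_ip x y.
Proof. by rewrite ![cd_ip _ y]cd_ipC cd_ipNr. Qed.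

Lemma cd_ipBl x y z : cd_ip (x - y) z = cd_ip x z - cd_ip y z.
Proof. by rewrite cd_ipDl cd_ipNl. Qed.

Lemma cd_ipZl a x y : cd_ip (a *: x) y = a * cd_ip x y.
Proof. by rewrite ![cd_ip _ y]cd_ipC cd_ipZr. Qed.

Lemma cd_ip_ge0 x : 0 <= cd_ip x x.
Proof. by have [->|/cd_ip_gt0/ltW//] := eqVneq x 0; rewrite cd_ip0r. Qed.

Lemma cd_ip_inj x y : (forall v, cd_ip v x = cd_ip v y) -> x = y.
Proof.
move=> xy; apply/eqP; rewrite -subr_eq0; apply: contraT => /cd_ip_gt0.
by rewrite cd_ipBr xy subrr ltxx.
Qed.

End InnerProduct.

Lemma cd_conjZ k a (x : cayley_dickson R k) :
  cd_conj (a *: x) = a *: cd_conj x.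
Proof. exact: linearZ. Qed.

Lemma cd_conj_one k : cd_conj (cd_one k) = cd_one k.
Proof. by elim: k => [|k IH] //=; rewrite IH oppr0. Qed.

Lemma cd_ip_one k : cd_ip (cd_one k) (cd_one k) = 1.
Proof. by elim: k => [|k IH] /=; rewrite ?mulr1// IH cd_ip0r addr0. Qed.

Lemma cd_mul_one k (x : cayley_dickson R k) :
  cd_mul (cd_one k) x = x /\ cd_mul x (cd_one k) = x.
Proof.
elim: k x => [|k IH] x /=; first by rewrite mul1r mulr1.
rewrite (linear0 (@cd_conj R k)) !cd_conj_one !cd_mul0l !cd_mul0r.
by rewrite !(IH _).1 !(IH _).2 subr0 addr0 add0r -surjective_pairing.
Qed.

Lemma cd_mul1l k (x : cayley_dickson R k) : cd_mul (cd_one k) x = x.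
Proof. by case: (cd_mul_one x). Qed.

Lemma cd_mul1r k (x : cayley_dickson R k) : cd_mul x (cd_one k) = x.
Proof. by case: (cd_mul_one x). Qed.

Lemma cd_conjM k (x y : cayley_dickson R k) :
  cd_conj (cd_mul x y) = cd_mul (cd_conj y) (cd_conj x).
Proof.
elim: k x y => [|k IH] x y /=; first by rewrite mulrC.
rewrite (linearB (@cd_conj R k)) /= !IH !cd_conjK (linearN (@cd_conj R k)) /=.
by rewrite !cd_mulNl !cd_mulNr !opprK opprD [- cd_mul y.2 _ - _]addrC.
Qed.

Lemma cd_ip_conj k (x y : cayley_dickson R k) :
  cd_ip (cd_conj x) (cd_conj y) = cd_ip x y.
Proof. by elim: k x y => [|k IH] x y //=; rewrite IH cd_ipNl cd_ipNr opprK. Qed.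

Lemma cd_ip_conj_l k (x y : cayley_dickson R k) :
  cd_ip (cd_conj x) y = cd_ip x (cd_conj y).
Proof. by rewrite -cd_ip_conj cd_conjK. Qed.

(** Left and right multiplications have as adjoints the multiplications by the
    conjugate. The two statements need each other in the induction. *)
Lemma cd_ip_mul k (x y z : cayley_dickson R k) :
  cd_ip (cd_mul x y) z = cd_ip y (cd_mul (cd_conj x) z) /\
  cd_ip (cd_mul x y) z = cd_ip x (cd_mul z (cd_conj y)).
Proof.
elim: k x y z => [|k IH] x y z /=; first by split; ring.
have IHl u v w : cd_ip (cd_mul u v) w = cd_ip v (cd_mul (cd_conj u) w) := (IH u v w).1.
have IHr u v w : cd_ip (cd_mul u v) w = cd_ip u (cd_mul w (cd_conj v)) := (IH u v w).2.
rewrite cd_ipBl cd_ipDl; split.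
  rewrite !cd_mulNr !cd_mulNl opprK !cd_ipDr cd_ipNr.
  rewrite (IHl x.1) (IHr (cd_conj y.2)) (IHr y.2) (IHl x.2).
  by rewrite !cd_ip_conj_l !cd_conjM !cd_conjK; ring.
rewrite (linearN (@cd_conj R k)) /= !cd_mulNl opprK !cd_ipDr cd_ipNr !cd_conjK.
rewrite (IHr x.1) (IHl (cd_conj y.2)) (IHl y.2) (IHr x.2) !cd_conjK.
by ring.
Qed.

Lemma cd_ip_mull k (x y z : cayley_dickson R k) :
  cd_ip (cd_mul x y) z = cd_ip y (cd_mul (cd_conj x) z).
Proof. by case: (cd_ip_mul x y z). Qed.

Lemma cd_ip_mulr k (x y z : cayley_dickson R k) :
  cd_ip (cd_mul x y) z = cd_ip x (cd_mul z (cd_conj y)).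
Proof. by case: (cd_ip_mul x y z). Qed.

Lemma cd_conj_real k (x : cayley_dickson R k) :
  cd_conj x = x -> x = cd_ip x (cd_one k) *: cd_one k.
Proof.
elim: k x => [|k IH] x /= xE; first by rewrite mulr1 -[_ *: _]/(_ * _) mulr1.
have [x1 x2] : cd_conj x.1 = x.1 /\ - x.2 = x.2 by rewrite -{2 4}xE.
have x20 : x.2 = 0.
  have : x.2 *+ 2 == 0 by rewrite mulr2n -{1}x2 addNr.
  by rewrite -scaler_nat scaler_eq0 pnatr_eq0 => /eqP.
rewrite [LHS]surjective_pairing x20 cd_ip0r addr0 {1}(IH _ x1); congr pair.
by rewrite scaler0.
Qed.

Lemma cd_mul_conj k (x : cayley_dickson R k) :
  cd_mul x (cd_conj x) = cd_ip x x *: cd_one k /\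
  cd_mul (cd_conj x) x = cd_ip x x *: cd_one k.
Proof.
elim: k x => [|k IH] x /=; first by rewrite -[_ *: _]/(_ * _) mulr1.
have IH1 u : cd_mul u (cd_conj u) = cd_ip u u *: cd_one k := (IH u).1.
have IH2 u : cd_mul (cd_conj u) u = cd_ip u u *: cd_one k := (IH u).2.
rewrite (linearN (@cd_conj R k)) /= !cd_mulNl !cd_mulNr !opprK !cd_conjK !IH1 !IH2.
rewrite -!scalerDl addrN addNr.
by split; congr pair; rewrite scaler0.
Qed.

Definition cd_assoc k := forall x y z : cayley_dickson R k,
  cd_mul x (cd_mul y z) = cd_mul (cd_mul x y) z.

Lemma cd_assoc_le2 k : (k <= 2)%N -> cd_assoc k.
Proof.
case: k => [|[|[|//]]] _; rewrite /cd_assoc.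
- by move=> x y z /=; ring.
- by move=> x y z /=; congr pair; ring.
- move=> x y z /=; congr (pair (pair _ _) (pair _ _)) => /=; ring.
Qed.

(** Stated with [cd_conj x] in place of one factor [x]. As [x + cd_conj x] is a
    real multiple of the unit, this is the usual pair of alternative laws, and it
    contains the composition property [|x y| = |x| |y|]. *)
Definition cd_alternative k := forall x y : cayley_dickson R k,
  cd_mul (cd_conj x) (cd_mul x y) = cd_ip x x *: y /\
  cd_mul (cd_mul y x) (cd_conj x) = cd_ip x x *: y.

Lemma cd_assoc_alternative k : cd_assoc k -> cd_alternative k.
Proof.
move=> A x y; split; first by rewrite A (cd_mul_conj x).2 cd_mulZl cd_mul1l.
by rewrite -A (cd_mul_conj x).1 cd_mulZr cd_mul1r.
Qed.

(** Doubling an associative algebra: with the parentheses removed, the products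
    [u (cd_conj u)] collapse to norms and the mixed terms cancel in pairs. *)
Lemma cd_assoc_alternativeS k : cd_assoc k -> cd_alternative k.+1.
Proof.
move=> A x y; rewrite /= !(linearN (@cd_conj R k)) /= !cd_mulNl !cd_mulNr !opprK.
rewrite !cd_conjK !cd_mulBr !cd_mulDr !cd_mulBl !cd_mulDl.
rewrite !(linearD (@cd_conj R k)) /= !(linearN (@cd_conj R k)) /= !cd_conjM !cd_conjK.
rewrite ?(cd_mulDl, cd_mulDr, cd_mulNr, cd_mulNl) -!A.
have conj_mulK u v : cd_mul (cd_conj u) (cd_mul u v) = cd_ip u u *: v :> cayley_dickson R k.
  by rewrite A (cd_mul_conj u).2 cd_mulZl cd_mul1l.
have mul_conjK u v : cd_mul u (cd_mul (cd_conj u) v) = cd_ip u u *: v :> cayley_dickson R k.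
  by rewrite A (cd_mul_conj u).1 cd_mulZl cd_mul1l.
have mulr_norm u v : cd_mul v (cd_mul (cd_conj u) u) = cd_ip u u *: v :> cayley_dickson R k.
  by rewrite (cd_mul_conj u).2 cd_mulZr cd_mul1r.
have mulr_norm' u v : cd_mul v (cd_mul u (cd_conj u)) = cd_ip u u *: v :> cayley_dickson R k.
  by rewrite (cd_mul_conj u).1 cd_mulZr cd_mul1r.
rewrite !conj_mulK !mul_conjK !mulr_norm !mulr_norm' !opprB.
split; apply: injective_projections => /=; rewrite scalerDl.
- by rewrite addrA subrK.
- by rewrite addrACA subrr addr0.
- by rewrite addrACA addNr addr0.
- by rewrite addrA subrK addrC.
Qed.

Lemma cd_alternative_le3 k : (k <= 3)%N -> cd_alternative k.
Proof.
rewrite leq_eqVlt => /orP[/eqP->|k2]; last exact/cd_assoc_alternative/cd_assoc_le2.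
by apply: cd_assoc_alternativeS; exact: cd_assoc_le2.
Qed.

Section Alternative.
Variable k : nat.
Hypothesis alt : cd_alternative k.
Implicit Types x y z w : cayley_dickson R k.

(** Polarisation of the left alternative law. *)
Lemma cd_alt_left x y z :
  cd_mul (cd_conj x) (cd_mul y z) + cd_mul (cd_conj y) (cd_mul x z)
    = (2 * cd_ip x y) *: z.
Proof.
have := (alt (x + y) z).1.
rewrite (linearD (@cd_conj R k)) /= !cd_mulDl !cd_mulDr !(alt _ _).1 => E.
apply: cd_ip_inj => v; move/(congr1 (cd_ip v)): E.
by rewrite !(cd_ipDl, cd_ipDr, cd_ipZr) [cd_ip y x]cd_ipC; lra.
Qed.

Lemma cd_alt_right x y z :
  cd_mul (cd_mul z x) (cd_conj y) + cd_mul (cd_mul z y) (cd_conj x)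
    = (2 * cd_ip x y) *: z.
Proof.
have := (alt (x + y) z).2.
rewrite (linearD (@cd_conj R k)) /= !cd_mulDr !cd_mulDl !(alt _ _).2 => E.
apply: cd_ip_inj => v; move/(congr1 (cd_ip v)): E.
by rewrite !(cd_ipDl, cd_ipDr, cd_ipZr) [cd_ip y x]cd_ipC; lra.
Qed.

Lemma cd_alt_left' x y z :
  cd_mul x (cd_mul (cd_conj y) z) + cd_mul y (cd_mul (cd_conj x) z)
    = (2 * cd_ip x y) *: z.
Proof. by have := cd_alt_left (cd_conj x) (cd_conj y) z; rewrite !cd_conjK cd_ip_conj. Qed.

(** The composition law [<x y, x y> = <x, x> <y, y>], polarised in both factors. *)
Lemma cd_ip_mul2 x y z w :
  cd_ip (cd_mul x y) (cd_mul z w) + cd_ip (cd_mul x w) (cd_mul z y)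
    = 2 * cd_ip x z * cd_ip y w.
Proof.
rewrite [cd_ip (cd_mul x w) _]cd_ipC !cd_ip_mull -cd_ipDr.
by rewrite cd_alt_left cd_ipZr.
Qed.

(** The middle Moufang law [(a p) (q a) = a (p q) a], polarised in [a], with
    [a x a = 2 <x', a> a - <a, a> x'] where [x'] is the conjugate of [x]. Pairing with [v]
    and moving factors across by adjunction and the composition law reduces it to
    a polarised alternative law. *)
Lemma cd_moufang (a c p q : cayley_dickson R k) :
  cd_mul (cd_mul a p) (cd_mul q c) + cd_mul (cd_mul c p) (cd_mul q a)
  = (2 * cd_ip (cd_conj (cd_mul p q)) c) *: a - (2 * cd_ip a c) *: cd_conj (cd_mul p q)
    + (2 * cd_ip (cd_conj (cd_mul p q)) a) *: c.
Proof.
apply: cd_ip_inj => v; rewrite !(cd_ipDr, cd_ipNr, cd_ipZr).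
set m := cd_conj (cd_mul p q).
have ip_m u : cd_ip p (cd_mul (cd_conj u) (cd_conj q)) = cd_ip m u.
  by rewrite -cd_ip_mull cd_ip_mulr /m cd_conjM cd_ipC.
have half b d : cd_ip v (cd_mul (cd_mul b p) (cd_mul q d))
    = 2 * cd_ip b v * cd_ip m d
      - cd_ip (cd_mul b (cd_mul (cd_conj d) (cd_conj q))) (cd_mul v p).
  rewrite [LHS]cd_ipC cd_ip_mulr cd_conjM -ip_m -cd_ip_mul2; ring.
have := congr1 (cd_ip (cd_mul v p)) (cd_alt_left' a c (cd_conj q)).
rewrite cd_ipDr cd_ipZr [cd_ip (cd_mul v p) (cd_conj q)]cd_ip_mulr.
rewrite (_ : cd_mul (cd_conj q) _ = m); last by rewrite /m cd_conjM.
rewrite !half ![cd_ip (cd_mul v p) _]cd_ipC [cd_ip a v]cd_ipC [cd_ip c v]cd_ipC.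
lra.
Qed.

End Alternative.

End CayleyDickson.

(** * The Jordan algebra of hermitian matrices *)

Lemma half_double (R : numFieldType) (V : lmodType R) (v : V) : 2^-1 *: (v + v) = v.
Proof. by rewrite -[v in v + v]scale1r -scalerDl scalerA mulVf ?scale1r// pnatr_eq0. Qed.

Section HermitianAlgebra.
Variables (R : realType) (k n : nat).
Local Notation M := (cdmx R k n).
Local Notation H := (herm_mx R k n).
Implicit Types X Y Z : M.

Lemma hermE X i j : X \in H -> cd_conj (X (i, j)) = X (j, i).
Proof. by move=> /herm_mxP XE; rewrite -{2}XE ffunE. Qed.

Lemma cd_mul_suml (I : finType) (P : pred I) (f : I -> cayley_dickson R k) y :
  cd_mul (\sum_(i | P i) f i) y = \sum_(i | P i) cd_mul (f i) y.
Proof.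
by elim/big_rec2: _ => [|i u v _ <-]; rewrite ?cd_mul0l ?cd_mulDl.
Qed.

Lemma cd_ip_sumr (I : finType) (P : pred I) (f : I -> cayley_dickson R k) y :
  cd_ip y (\sum_(i | P i) f i) = \sum_(i | P i) cd_ip y (f i).
Proof.
by elim/big_rec2: _ => [|i u v _ <-]; rewrite ?cd_ip0r ?cd_ipDr.
Qed.

Lemma cd_ip_suml (I : finType) (P : pred I) (f : I -> cayley_dickson R k) y :
  cd_ip (\sum_(i | P i) f i) y = \sum_(i | P i) cd_ip (f i) y.
Proof. by rewrite cd_ipC cd_ip_sumr; apply: eq_bigr => i _; rewrite cd_ipC. Qed.

Lemma cd_mulmx_linear_r X : linear (cd_mulmx X).
Proof.
move=> a Y Z; apply/ffunP => ij; rewrite !ffunE scaler_sumr -big_split/=.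
by apply: eq_bigr => j _; rewrite !ffunE cd_mulDr cd_mulZr.
Qed.

HB.instance Definition _ X := GRing.isLinear.Build R M M *:%R (cd_mulmx X)
  (cd_mulmx_linear_r X).

Lemma cd_mulmx_linear_l Y : linear (fun X => cd_mulmx X Y).
Proof.
move=> a X Z; apply/ffunP => ij; rewrite !ffunE scaler_sumr -big_split/=.
by apply: eq_bigr => j _; rewrite !ffunE cd_mulDl cd_mulZl.
Qed.

Lemma jordan_mulC : commutative (@jordan_mul R k n).
Proof. by move=> X Y; rewrite /jordan_mul addrC. Qed.

Lemma jordan_mul_linear X : linear (jordan_mul X).
Proof.
move=> a Y Z; rewrite /jordan_mul linearP /= cd_mulmx_linear_l addrACA -scalerDr.
by rewrite [LHS]scalerDr !scalerA [_^-1 * a]mulrC.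
Qed.

HB.instance Definition _ X := GRing.isLinear.Build R M M *:%R (jordan_mul X)
  (jordan_mul_linear X).

Lemma jordan_mul_sqr X : jordan_mul X X = cd_mulmx X X.
Proof. exact: half_double. Qed.

Lemma adjmx_mul X Y : adjmx (cd_mulmx X Y) = cd_mulmx (adjmx Y) (adjmx X).
Proof.
apply/ffunP => -[i j]; rewrite !ffunE linear_sum; apply: eq_bigr => m _ /=.
by rewrite !ffunE cd_conjM.
Qed.

Lemma jordan_mul_herm X Y : X \in H -> Y \in H -> jordan_mul X Y \in H.
Proof.
move=> /herm_mxP XE /herm_mxP YE; apply/herm_mxP.
by rewrite /jordan_mul linearZ linearD /= !adjmx_mul XE YE addrC.
Qed.

(** The real part of a diagonal entry of a Jordan product is the scalar product
    of two rows: the trace form of the algebra is the sum of these. *)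
Lemma jordan_mul_diag X Y i : X \in H -> Y \in H ->
  cd_ip (jordan_mul X Y (i, i)) (cd_one R k) = \sum_j cd_ip (X (i, j)) (Y (i, j)).
Proof.
move=> XH YH; rewrite /jordan_mul !ffunE cd_ipZl cd_ipDl !cd_ip_suml -big_split/=.
have entry j : cd_ip (cd_mul (X (i, j)) (Y (j, i))) (cd_one R k)
      + cd_ip (cd_mul (Y (i, j)) (X (j, i))) (cd_one R k)
    = 2 * cd_ip (X (i, j)) (Y (i, j)).
  rewrite !cd_ip_mulr !cd_mul1l !hermE// [cd_ip (Y _) _]cd_ipC; ring.
by rewrite (eq_bigr _ (fun j _ => entry j)) -mulr_sumr mulKf ?pnatr_eq0.
Qed.

Lemma herm_diagE X i : X \in H ->
  X (i, i) = cd_ip (X (i, i)) (cd_one R k) *: cd_one R k.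
Proof. by move=> XH; apply: cd_conj_real; rewrite hermE. Qed.

Lemma cd_ip_diag X Y i : X \in H -> Y \in H ->
  cd_ip (X (i, i)) (Y (i, i))
    = cd_ip (X (i, i)) (cd_one R k) * cd_ip (Y (i, i)) (cd_one R k).
Proof.
move=> XH YH; rewrite {1}herm_diagE// {1}(herm_diagE i YH) cd_ipZl cd_ipZr.
by rewrite cd_ip_one mulr1.
Qed.

(** This is the trace form [Re Tr (X Y)] on hermitian matrices, written on all
    matrices, where it is a Euclidean product without any hermitian condition. *)
Definition mxip X Y : R := \sum_i \sum_j cd_ip (X (i, j)) (Y (i, j)).

Lemma mxipC : commutative mxip.
Proof.
by move=> X Y; apply: eq_bigr => i _; apply: eq_bigr => j _; rewrite cd_ipC.
Qed.

Lemma mxip_scalar X : scalar (mxip X).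
Proof.
move=> a Y Z; rewrite /mxip mulr_sumr -big_split; apply: eq_bigr => i _.
rewrite /= mulr_sumr -big_split; apply: eq_bigr => j _.
by rewrite !ffunE cd_ipDr cd_ipZr.
Qed.

Lemma mxip_gt0 X : X != 0 -> 0 < mxip X X.
Proof.
have ge0 i j : 0 <= cd_ip (X (i, j)) (X (i, j)) by exact: cd_ip_ge0.
move=> X0; rewrite lt_def sumr_ge0 ?andbT => [|i _]; last by rewrite sumr_ge0.
apply: contra X0 => /eqP/psumr_eq0P Xij; apply/eqP/ffunP => -[i j].
rewrite ffunE; apply/eqP; apply: contraT => /cd_ip_gt0.
have /psumr_eq0P -> // := Xij (fun i _ => sumr_ge0 _ (fun j _ => ge0 i j)) i isT.
by rewrite ltxx.
Qed.

Lemma mxip_mull X Y Z : mxip (cd_mulmx X Y) Z = mxip Y (cd_mulmx (adjmx X) Z).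
Proof.
rewrite /mxip exchange_big [RHS]exchange_big; apply: eq_bigr => j _ /=.
under eq_bigr => i _ do rewrite ffunE cd_ip_suml.
under [RHS]eq_bigr => i _ do rewrite ffunE cd_ip_sumr.
rewrite exchange_big; apply: eq_bigr => m _; apply: eq_bigr => i _ /=.
by rewrite cd_ip_mull ffunE.
Qed.

Lemma mxip_mulr X Y Z : mxip (cd_mulmx X Y) Z = mxip X (cd_mulmx Z (adjmx Y)).
Proof.
rewrite /mxip; apply: eq_bigr => i _ /=.
under eq_bigr => j _ do rewrite ffunE cd_ip_suml.
under [RHS]eq_bigr => j _ do rewrite ffunE cd_ip_sumr.
rewrite exchange_big; apply: eq_bigr => m _; apply: eq_bigr => j _ /=.
by rewrite cd_ip_mulr ffunE.
Qed.

(** Associativity of the trace form holds over every Cayley-Dickson algebra, since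
    it only uses that multiplication by the conjugate is the adjoint. *)
Lemma mxip_jordan_mul X Y Z : X \in H ->
  mxip (jordan_mul X Y) Z = mxip Y (jordan_mul X Z).
Proof.
move=> /herm_mxP XE; rewrite /jordan_mul (scalarM _ _ (mxip_scalar Y)).
rewrite mxipC (scalarM _ _ (mxip_scalar Z)) (scalarD _ _ (mxip_scalar Z)).
rewrite ![mxip Z _]mxipC (scalarD _ _ (mxip_scalar Y)).
by rewrite mxip_mull mxip_mulr XE.
Qed.

Definition mx_one : M := [ffun ij => if ij.1 == ij.2 then cd_one R k else 0].

Lemma mx_one_herm : mx_one \in H.
Proof.
apply/herm_mxP/ffunP => -[i j]; rewrite !ffunE /= eq_sym.
by case: ifP => _; rewrite ?cd_conj_one ?linear0.
Qed.

Lemma jordan_mul_one X : jordan_mul mx_one X = X.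
Proof.
have E1 : cd_mulmx mx_one X = X.
  apply/ffunP => -[i j]; rewrite ffunE (bigD1 i)//= ffunE eqxx cd_mul1l.
  by rewrite big1 ?addr0// => m mi; rewrite ffunE/= eq_sym (negPf mi) cd_mul0l.
have E2 : cd_mulmx X mx_one = X.
  apply/ffunP => -[i j]; rewrite ffunE (bigD1 j)//= ffunE eqxx cd_mul1r.
  by rewrite big1 ?addr0// => m mj; rewrite ffunE/= (negPf mj) cd_mul0r.
by rewrite /jordan_mul E1 E2 half_double.
Qed.

Definition jordan_law := forall X Y, X \in H -> Y \in H ->
  jordan_mul (jordan_mul X X) (jordan_mul X Y)
    = jordan_mul X (jordan_mul (jordan_mul X X) Y).

(** Over an associative algebra matrix multiplication is associative, and both sides
    expand to the same four products of three [X] and one [Y]. *)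
Lemma cd_assoc_jordan_law : cd_assoc R k -> jordan_law.
Proof.
move=> A X Y _ _.
have mulA (U V W : M) : cd_mulmx U (cd_mulmx V W) = cd_mulmx (cd_mulmx U V) W.
  apply/ffunP => -[i j]; rewrite !ffunE /=.
  under eq_bigr => l _ do rewrite ffunE linear_sum.
  rewrite exchange_big; apply: eq_bigr => m _ /=.
  by rewrite ffunE /= cd_mul_suml; apply: eq_bigr => l _; rewrite A.
have mulDl (U V W : M) : cd_mulmx (U + V) W = cd_mulmx U W + cd_mulmx V W.
  by have := cd_mulmx_linear_l W 1 U V; rewrite !scale1r.
have mul0l (W : M) : cd_mulmx 0 W = 0 by apply: (addrI (cd_mulmx 0 W)); rewrite -mulDl !addr0.
have mulZl a (U W : M) : cd_mulmx (a *: U) W = a *: cd_mulmx U W.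
  by have := cd_mulmx_linear_l W a U 0; rewrite mul0l !addr0.
have mulDr (U V W : M) : cd_mulmx W (U + V) = cd_mulmx W U + cd_mulmx W V.
  exact: linearD.
have mulZr a (U W : M) : cd_mulmx W (a *: U) = a *: cd_mulmx W U by exact: linearZ.
rewrite !jordan_mul_sqr /jordan_mul !(mulZl, mulZr) !(mulDl, mulDr).
rewrite -!scalerDr -!mulA; congr (_ *: (_ *: _)).
exact: addrACA.
Qed.

Section Algebra.
Hypothesis law : jordan_law.

Definition herm_mul (x y : subvs_of H) : subvs_of H :=
  vsproj H (jordan_mul (vsval x) (vsval y)).

Lemma herm_mulE x y : vsval (herm_mul x y) = jordan_mul (vsval x) (vsval y).
Proof. by rewrite vsprojK// jordan_mul_herm// subvsP. Qed.

Definition herm_ip (x y : subvs_of H) : R := mxip (vsval x) (vsval y).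

Definition herm_one : subvs_of H := vsproj H mx_one.

Lemma herm_oneE : vsval herm_one = mx_one.
Proof. by rewrite vsprojK// mx_one_herm. Qed.

Let vsval_inj (x y : subvs_of H) : vsval x = vsval y -> x = y.
Proof. exact: val_inj. Qed.

Lemma herm_mulC : commutative herm_mul.
Proof. by move=> x y; rewrite /herm_mul jordan_mulC. Qed.

Lemma herm_mul_linear x : linear (herm_mul x).
Proof.
by move=> a y z; rewrite /herm_mul !linearP.
Qed.

Lemma herm_ipC : commutative herm_ip. Proof. by move=> x y; exact: mxipC. Qed.

Lemma herm_ip_scalar x : scalar (herm_ip x).
Proof. by move=> a y z; rewrite /herm_ip linearP mxip_scalar. Qed.

Lemma herm_ip_gt0 x : x != 0 -> 0 < herm_ip x x.
Proof. by move=> x0; apply: mxip_gt0; rewrite -[_ == 0]val_eqE. Qed.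

Lemma herm_ip_mul x y z : herm_ip (herm_mul x y) z = herm_ip y (herm_mul x z).
Proof. by rewrite /herm_ip !herm_mulE mxip_jordan_mul ?subvsP. Qed.

Lemma herm_mul1 x : herm_mul herm_one x = x.
Proof. by apply: vsval_inj; rewrite herm_mulE herm_oneE jordan_mul_one. Qed.

Lemma herm_jordan x y :
  herm_mul (herm_mul x x) (herm_mul x y) = herm_mul x (herm_mul (herm_mul x x) y).
Proof. by apply: vsval_inj; rewrite !herm_mulE law ?subvsP. Qed.

Definition herm_euclidean_jordan : euclidean_jordan (subvs_of H) :=
  EuclideanJordan herm_mulC herm_mul_linear herm_ipC herm_ip_scalar herm_ip_gt0
    herm_ip_mul herm_mul1 herm_jordan.

Lemma psd_coneP (x : subvs_of H) :
  psd_cone R k n x <-> exists y, x = herm_mul y y.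
Proof.
split=> -[y xE]; exists y; last by rewrite xE herm_mulE.
by apply: vsval_inj; rewrite herm_mulE.
Qed.

Lemma psd_cone_dual (x : subvs_of H) :
  psd_cone R k n x <-> forall y, 0 <= herm_ip x (herm_mul y y).
Proof.
rewrite psd_coneP; split=> [[y ->] u|psdx].
  exact: (ip_sqr_sqr herm_euclidean_jordan).
have psdx' : dual_psd herm_euclidean_jordan {:subvs_of H} x by move=> u _; exact: psdx.
have [y _ ->] := dual_psd_square (subalgebraT herm_euclidean_jordan) (memvf x) psdx'.
by exists y.
Qed.

End Algebra.

End HermitianAlgebra.

(** * The Jordan identity for octonionic matrices of order three *)

Section JordanTriple.
Variables (R : realType) (k : nat).
Local Notation O := (cayley_dickson R k).
Implicit Types (al be ga : R) (a b c v : O).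

(** A hermitian matrix of order three over the octonions is encoded by its three
    real diagonal entries [al_i] and the three entries [a_i] at the places
    [(i + 1, i + 2)], indices being cyclic. In these coordinates the Jordan product has
    cyclic symmetry: [cube_diag] and [cube_off] are its diagonal and off-diagonal
    coordinates, and every identity needs to be proved for one index only. *)
Definition cube_diag al be a1 b1 a2 b2 : R := al * be + cd_ip a1 b1 + cd_ip a2 b2.

Definition cube_off al1 al2 be1 be2 a0 b0 a1 b1 a2 b2 : O :=
  2^-1 *: ((al1 + al2) *: b0 + (be1 + be2) *: a0
           + cd_conj (cd_mul a1 b2) + cd_conj (cd_mul b1 a2)).

(** The trilinear form [Re ((x y) z)] is invariant under cyclic permutations. *)
Lemma cd_ip_cycle (x y z : O) :
  cd_ip x (cd_conj (cd_mul y z)) = cd_ip y (cd_conj (cd_mul z x)).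
Proof. by rewrite cd_ipC cd_conjM cd_ip_mull cd_conjK cd_ip_conj_l. Qed.

(** The vanishing of an off-diagonal entry of [X Y - Y X]. *)
Definition offdiag_commute al1 al2 be1 be2 a0 b0 a1 b1 a2 b2 :=
  (al1 - al2) *: b0 - (be1 - be2) *: a0
    + cd_conj (cd_mul b1 a2) - cd_conj (cd_mul a1 b2) = 0.

(** The part of an off-diagonal entry of [X (Y Z) - Y (X Z)] which depends on the
    entry [c] of [Z] at the same place: it does not follow from the commutation of
    [X] and [Y] alone, because it involves associators of entries of [X] and [Y]
    with [c]. *)
Definition offdiag_moufang a0 b0 a1 b1 a2 b2 c :=
  (4 * cd_ip b0 c) *: a0 - (4 * cd_ip a0 c) *: b0
    + (cd_mul (cd_mul c b1) (cd_conj a1) - cd_mul (cd_mul c a1) (cd_conj b1))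
    + (cd_mul (cd_conj a2) (cd_mul b2 c) - cd_mul (cd_conj b2) (cd_mul a2 c)) = 0.

Lemma cube_diag_commute al0 al1 al2 be0 be1 be2 ga0 ga1 ga2
    a0 a1 a2 b0 b1 b2 c0 c1 c2 :
  offdiag_commute al2 al0 be2 be0 a1 b1 a2 b2 a0 b0 ->
  offdiag_commute al0 al1 be0 be1 a2 b2 a0 b0 a1 b1 ->
  cube_diag al0 (cube_diag be0 ga0 b1 c1 b2 c2)
      a1 (cube_off be2 be0 ga2 ga0 b1 c1 b2 c2 b0 c0)
      a2 (cube_off be0 be1 ga0 ga1 b2 c2 b0 c0 b1 c1)
  = cube_diag be0 (cube_diag al0 ga0 a1 c1 a2 c2)
      b1 (cube_off al2 al0 ga2 ga0 a1 c1 a2 c2 a0 c0)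
      b2 (cube_off al0 al1 ga0 ga1 a2 c2 a0 c0 a1 c1).
Proof.
move=> /(congr1 (cd_ip c1)) R1 /(congr1 (cd_ip c2)) R2; move: R1 R2.
rewrite /cube_diag /cube_off !(cd_ipDr, cd_ipNr, cd_ipZr, cd_ip0r).
rewrite -(cd_ip_cycle a1 c2 b0) -(cd_ip_cycle b1 c2 a0).
rewrite (cd_ip_cycle c1 b2 a0) (cd_ip_cycle c1 a2 b0).
rewrite ![cd_ip _ c1]cd_ipC.
rewrite ![cd_ip _ c2]cd_ipC [cd_ip b1 a1]cd_ipC [cd_ip b2 a2]cd_ipC.
rewrite (cd_ip_cycle a1 b2 c0) (cd_ip_cycle b1 a2 c0).
lra.
Qed.

(** After pairing with an arbitrary [v], the difference of the two sides is a
    linear combination of the commutation relations, multiplied on the appropriate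
    side by the entries of [Z], of four polarised alternative laws that deal with the
    entries [c1] and [c2], and of the last hypothesis, which deals with [c0]. *)
Lemma cube_off_commute al0 al1 al2 be0 be1 be2 ga0 ga1 ga2
    a0 a1 a2 b0 b1 b2 c0 c1 c2 :
  cd_alternative R k ->
  offdiag_commute al1 al2 be1 be2 a0 b0 a1 b1 a2 b2 ->
  offdiag_commute al2 al0 be2 be0 a1 b1 a2 b2 a0 b0 ->
  offdiag_commute al0 al1 be0 be1 a2 b2 a0 b0 a1 b1 ->
  offdiag_moufang a0 b0 a1 b1 a2 b2 c0 ->
  cube_off al1 al2 (cube_diag be1 ga1 b2 c2 b0 c0) (cube_diag be2 ga2 b0 c0 b1 c1)
      a0 (cube_off be1 be2 ga1 ga2 b0 c0 b1 c1 b2 c2)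
      a1 (cube_off be2 be0 ga2 ga0 b1 c1 b2 c2 b0 c0)
      a2 (cube_off be0 be1 ga0 ga1 b2 c2 b0 c0 b1 c1)
  = cube_off be1 be2 (cube_diag al1 ga1 a2 c2 a0 c0) (cube_diag al2 ga2 a0 c0 a1 c1)
      b0 (cube_off al1 al2 ga1 ga2 a0 c0 a1 c1 a2 c2)
      b1 (cube_off al2 al0 ga2 ga0 a1 c1 a2 c2 a0 c0)
      b2 (cube_off al0 al1 ga0 ga1 a2 c2 a0 c0 a1 c1).
Proof.
move=> alt R0 R1 R2 Q0; apply: cd_ip_inj => v.
have R0v := congr1 (cd_ip v) R0.
have R1v := congr1 (fun x => cd_ip v (cd_conj (cd_mul x c2))) R1.
have R2v := congr1 (fun x => cd_ip v (cd_conj (cd_mul c1 x))) R2.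
have Q0v := congr1 (cd_ip v) Q0.
have L1 := congr1 (cd_ip v) (cd_alt_right alt c1 a1 b0).
have L2 := congr1 (cd_ip v) (cd_alt_right alt c1 b1 a0).
have L3 := congr1 (cd_ip v) (cd_alt_left alt c2 a2 b0).
have L4 := congr1 (cd_ip v) (cd_alt_left alt c2 b2 a0).
have {}R0v g := congr1 (fun x => g * x) R0v.
have conjD : {morph @cd_conj R k : x y / x + y} by exact: linearD.
have conjN : {morph @cd_conj R k : x / - x} by exact: linearN.
have conjZ (g : R) : {morph @cd_conj R k : x / g *: x} by move=> x; exact: linearZ.
have expand := (cd_mulDl, cd_mulDr, cd_mulNl, cd_mulNr, cd_mulZl, cd_mulZr,
  conjD, conjN, conjZ, cd_conjM, cd_conjK, cd_ipDr, cd_ipNr, cd_ipZr, cd_ip0r, cd_mul0l, cd_mul0r).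
move: (R0v ga1) (R0v ga2) R1v R2v Q0v L1 L2 L3 L4 => {R0v}.
rewrite /cube_diag /cube_off !expand !(linear0 (@cd_conj R k)) /=.
rewrite ?(cd_mul0l, cd_mul0r, cd_ip0r).
rewrite ![cd_ip c1 _]cd_ipC ![cd_ip c2 _]cd_ipC.
lra.
Qed.

(** The cubic terms of an off-diagonal entry of [X X^2 - X^2 X] are of the form
    covered by the alternative laws, and the norms which they produce cancel against
    those on the diagonal of [X^2]. *)
Lemma square_offdiag_commute al0 al1 al2 a0 a1 a2 :
  cd_alternative R k ->
  offdiag_commute al1 al2 (cube_diag al1 al1 a2 a2 a0 a0) (cube_diag al2 al2 a0 a0 a1 a1)
    a0 (cube_off al1 al2 al1 al2 a0 a0 a1 a1 a2 a2)
    a1 (cube_off al2 al0 al2 al0 a1 a1 a2 a2 a0 a0)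
    a2 (cube_off al0 al1 al0 al1 a2 a2 a0 a0 a1 a1).
Proof.
move=> alt; apply: cd_ip_inj => v.
have conjD : {morph @cd_conj R k : x y / x + y} by exact: linearD.
have conjZ (g : R) : {morph @cd_conj R k : x / g *: x} by move=> x; exact: linearZ.
have expand := (cd_mulDl, cd_mulDr, cd_mulZl, cd_mulZr,
  conjD, conjZ, cd_conjM, cd_conjK, cd_ipDr, cd_ipNr, cd_ipZr, cd_ip0r).
rewrite /cube_diag /cube_off !expand !(alt _ _).1 !(alt _ _).2 !cd_ipZr.
lra.
Qed.

(** The off-diagonal entries of [X^2] are [(al + be) a_0] plus the conjugate of
    [a_1 a_2]. The first terms cancel; in what remains, [a_1] and [a_2] enter only through
    products governed by the polarised alternative and Moufang laws. *)
Lemma square_moufang al0 al1 al2 a0 a1 a2 c :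
  cd_alternative R k ->
  offdiag_moufang a0 (cube_off al1 al2 al1 al2 a0 a0 a1 a1 a2 a2)
    a1 (cube_off al2 al0 al2 al0 a1 a1 a2 a2 a0 a0)
    a2 (cube_off al0 al1 al0 al1 a2 a2 a0 a0 a1 a1) c.
Proof.
move=> alt.
have bE al be (x y z : O) :
    cube_off al be al be x x y y z z = (al + be) *: x + cd_conj (cd_mul y z).
  apply: cd_ip_inj => v; rewrite /cube_off !(cd_ipDr, cd_ipZr); lra.
rewrite /offdiag_moufang !bE; apply: cd_ip_inj => v.
have conjD : {morph @cd_conj R k : x y / x + y} by exact: linearD.
have conjZ (g : R) : {morph @cd_conj R k : x / g *: x} by move=> x; exact: linearZ.
have expand := (cd_mulDl, cd_mulDr, cd_mulZl, cd_mulZr, conjD, conjZ, cd_conjM,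
  cd_conjK, cd_ipDr, cd_ipDl, cd_ipNr, cd_ipZr, cd_ipZl, cd_ip0r).
have S1 : cd_ip (cd_conj (cd_mul a2 a0)) a1 = cd_ip (cd_conj (cd_mul a1 a2)) a0.
  by rewrite cd_ipC cd_ip_cycle cd_ip_cycle cd_ipC.
have S2 : cd_ip a2 (cd_conj (cd_mul a0 a1)) = cd_ip (cd_conj (cd_mul a1 a2)) a0.
  by rewrite cd_ip_cycle cd_ipC.
have := congr1 (cd_ip v) (cd_alt_right alt (cd_conj (cd_mul a2 a0)) a1 c).
have := congr1 (cd_ip v) (cd_alt_left alt a2 (cd_conj (cd_mul a0 a1)) c).
have := congr1 (cd_ip v) (cd_moufang alt a0 c a1 a2).
rewrite S1 S2 !expand.
lra.
Qed.

End JordanTriple.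

Section CubicMatrices.
Variables (R : realType) (k : nat).
Local Notation O := (cayley_dickson R k).
Local Notation H := (herm_mx R k 3).
Implicit Types (X Y Z : cdmx R k 3) (i j : 'I_3).
Local Notation s := (@ordS 3).

Definition mx_diag X i : R := cd_ip (X (i, i)) (cd_one R k).
Definition mx_off X i : O := X (s i, s (s i)).

Lemma ordS3 i : s (s (s i)) = i.
Proof. by apply/val_inj; case: i => [[|[|[]]]]. Qed.

Lemma cover3 i j : [|| j == i, j == s i | j == s (s i)].
Proof. by case: i j => [[|[|[]]]] // ? [[|[|[]]]]. Qed.

Lemma neq3 i : [/\ s i != i, s (s i) != i & s (s i) != s i].
Proof. by case: i => [[|[|[]]]]. Qed.

Lemma sum_ord3 (V : nmodType) (F : 'I_3 -> V) i :
  \sum_j F j = F i + F (s i) + F (s (s i)).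
Proof.
have [n1 n2 n3] := neq3 i.
rewrite (bigD1 i)//= (bigD1 (s i))//= (bigD1 (s (s i)))/=; last by rewrite n2.
rewrite big1 ?addr0 ?addrA// => j /andP[/andP[j1 j2] j3].
by have := cover3 i j; rewrite (negPf j1) (negPf j2) (negPf j3).
Qed.

Lemma herm_eq3 X Y : X \in H -> Y \in H ->
  (forall i, mx_diag X i = mx_diag Y i) -> (forall i, mx_off X i = mx_off Y i) ->
  X = Y.
Proof.
move=> XH YH ed eo; apply/ffunP => -[i j].
have off l : X (l, s l) = Y (l, s l).
  by have := eo (s (s l)); rewrite /mx_off !ordS3.
case/or3P: (cover3 i j) => /eqP ->.
- by rewrite herm_diagE// [RHS]herm_diagE//; congr (_ *: _); exact: ed.
- exact: off.
- by rewrite -!(hermE (s (s i)) i)//; have := off (s (s i)); rewrite ordS3 => ->.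
Qed.

Lemma mx_diag_jordan X Y i : X \in H -> Y \in H -> mx_diag (jordan_mul X Y) i =
  cube_diag (mx_diag X i) (mx_diag Y i) (mx_off X (s i)) (mx_off Y (s i))
    (mx_off X (s (s i))) (mx_off Y (s (s i))).
Proof.
move=> XH YH; rewrite /mx_diag jordan_mul_diag//.
rewrite (sum_ord3 _ i) /cube_diag /mx_off !ordS3.
rewrite -(hermE (s (s i)) i XH) -(hermE (s (s i)) i YH) cd_ip_conj.
by rewrite cd_ip_diag// -addrA [X in _ + X]addrC addrA.
Qed.

Lemma mx_off_jordan X Y i : X \in H -> Y \in H -> mx_off (jordan_mul X Y) i =
  cube_off (mx_diag X (s i)) (mx_diag X (s (s i))) (mx_diag Y (s i)) (mx_diag Y (s (s i)))
    (mx_off X i) (mx_off Y i) (mx_off X (s i)) (mx_off Y (s i))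
    (mx_off X (s (s i))) (mx_off Y (s (s i))).
Proof.
move=> XH YH; rewrite /mx_off /jordan_mul !ffunE /= !(sum_ord3 _ i) !ordS3 /cube_off.
rewrite -!(hermE i (s i))// -!(hermE (s (s i)) i)//.
rewrite (herm_diagE (s i) XH) (herm_diagE (s (s i)) XH) (herm_diagE (s i) YH)
  (herm_diagE (s (s i)) YH) -!/(mx_diag _ _) !(cd_mulZl, cd_mulZr, cd_mul1l, cd_mul1r) -!cd_conjM.
apply: cd_ip_inj => v; rewrite !(cd_ipDr, cd_ipZr); lra.
Qed.

(** The multiplications by [X] and by [Y] commute as soon as the two off-diagonal
    conditions hold; the Jordan identity is the case [Y = X^2]. *)
Lemma cubic_commute X Y Z : cd_alternative R k -> X \in H -> Y \in H -> Z \in H ->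
  (forall i, offdiag_commute (mx_diag X (s i)) (mx_diag X (s (s i)))
    (mx_diag Y (s i)) (mx_diag Y (s (s i))) (mx_off X i) (mx_off Y i)
    (mx_off X (s i)) (mx_off Y (s i)) (mx_off X (s (s i))) (mx_off Y (s (s i)))) ->
  (forall i c, offdiag_moufang (mx_off X i) (mx_off Y i) (mx_off X (s i))
    (mx_off Y (s i)) (mx_off X (s (s i))) (mx_off Y (s (s i))) c) ->
  jordan_mul X (jordan_mul Y Z) = jordan_mul Y (jordan_mul X Z).
Proof.
move=> alt XH YH ZH comm mouf.
have XZH := jordan_mul_herm XH ZH; have YZH := jordan_mul_herm YH ZH.
apply: herm_eq3 => [||i|i]; try exact: jordan_mul_herm.
  rewrite !mx_diag_jordan// !mx_off_jordan// !ordS3.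
  apply: cube_diag_commute; first by have := comm (s i); rewrite !ordS3.
  by have := comm (s (s i)); rewrite !ordS3.
rewrite !mx_off_jordan// !mx_diag_jordan// !ordS3.
apply: cube_off_commute => //.
- by have := comm (s i); rewrite !ordS3.
- by have := comm (s (s i)); rewrite !ordS3.
Qed.

Lemma cubic_jordan_law : cd_alternative R k -> jordan_law R k 3.
Proof.
move=> alt X Z XH ZH.
apply/esym/cubic_commute => //; first exact: jordan_mul_herm.
  by move=> i; rewrite !mx_diag_jordan// !mx_off_jordan// !ordS3;
    exact: square_offdiag_commute.
by move=> i c; rewrite !mx_off_jordan// !ordS3; exact: square_moufang.
Qed.

End CubicMatrices.

(** Order three is needed for the octonions only: the other three algebras are
    associative. *)
Lemma herm_jordan_law (R : realType) (k n : nat) :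
  (k <= 3)%N -> (k = 3%N -> n = 3%N) -> jordan_law R k n.
Proof.
move=> k3 n3; have [k2|k2] := leqP k 2.
  exact/cd_assoc_jordan_law/cd_assoc_le2.
have kE : k = 3%N by apply/eqP; rewrite eqn_leq k3.
by rewrite (n3 kE); apply/cubic_jordan_law/cd_alternative_le3.
Qed.

(** * A lower bound for products by the variance *)

Section MeanInequality.
Variable R : realFieldType.

Lemma bernoulli_ge (y : R) n : -1 <= y -> 1 + n%:R * y <= (1 + y) ^+ n.
Proof.
move=> y1; elim: n => [|n IH]; first by rewrite mul0r addr0 expr0.
rewrite exprS -natr1; apply: (@le_trans _ _ ((1 + y) * (1 + n%:R * y))).
  rewrite -subr_ge0 (_ : _ - _ = n%:R * y ^+ 2); last by ring.
  by rewrite mulr_ge0 ?sqr_ge0.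
by rewrite ler_wpM2l//; lra.
Qed.

(** The sum of the squares [(x - m)^2] is nonnegative. The bound is linear in
    the sum, so that [m] may be chosen afterwards. *)
Lemma sum_sqr_ge (s : seq R) (m : R) :
  2 * m * \sum_(x <- s) x - (size s)%:R * m ^+ 2 <= \sum_(x <- s) x ^+ 2.
Proof.
elim: s => [|x s IH]; first by rewrite !big_nil mulr0 mul0r subr0.
rewrite !big_cons /= -natr1; have := sqr_ge0 (x - m); nra.
Qed.

Lemma exists_le_mean (s : seq R) :
  s != [::] -> \sum_(x <- s) x = (size s)%:R -> exists2 b, b \in s & b <= 1.
Proof.
move=> s0 sum_s; apply: contrapT => nb.
have gt1 x : x \in s -> 1 < x.
  by move=> xs; rewrite ltNge; apply/negP => x1; apply: nb; exists x.
have : (size s)%:R < \sum_(x <- s) x.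
  rewrite {sum_s nb}; case: s s0 gt1 => // x s _ gt1.
  rewrite big_cons /= -nat1r ltr_leD ?gt1 ?mem_head//.
  rewrite -sum1_size natr_sum big_seq [leRHS]big_seq ler_sum// => y ys.
  by rewrite ltW// gt1// in_cons ys orbT.
by rewrite sum_s ltxx.
Qed.

(** For numbers of mean one the product differs from one by at most a multiple of
    the variance. Induction on the number of terms: remove an element [b <= 1],
    which exists because the mean is one, and rescale the others, whose mean is
    [1 + y] with [N y = 1 - b]. The rescaled bound gets multiplied by
    [b (1 + y)^N], which Bernoulli's inequality controls from both sides. *)
Lemma prod_ge_variance (s : seq R) : s != [::] -> all (>= 0) s ->
  \sum_(x <- s) x = (size s)%:R ->
  (size s)%:R - ((size s)%:R - 1) / (size s)%:R * \sum_(x <- s) x ^+ 2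
    <= \prod_(x <- s) x.
Proof.
have [r] := ubnP (size s); elim: r s => // r IH s sr s0 s_ge0 sum_s.
have [b bs b1] := exists_le_mean s0 sum_s.
have perm_s := perm_to_rem bs.
set s' := rem b s in perm_s.
have size_s : size s = (size s').+1 by rewrite (perm_size perm_s).
have b0 : 0 <= b by move/allP: s_ge0; apply.
have s'_ge0 : all (>= 0) s'.
  by move: s_ge0; rewrite (perm_all _ perm_s) /= => /andP[].
move: sum_s; rewrite !(perm_big _ perm_s)/= !big_cons size_s -natr1 => sum_s.
have [s'0|s'0] := eqVneq s' [::].
  by move: sum_s; rewrite s'0 !big_nil/= => sum_s; lra.
have n0 : (0 < size s')%N by rewrite lt0n size_eq0.
set n := size s' in size_s n0 sum_s *.
have N0 : (0 : R) < n%:R by rewrite ltr0n.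
set N : R := n%:R in sum_s N0 *.
set P := \sum_(x <- s') x ^+ 2; set S := \sum_(x <- s') x in sum_s.
(* The excess of the mean of the remaining [N] numbers over one. *)
pose y := (1 - b) / N.
have yN : y * N = 1 - b by rewrite /y divfK ?gt_eqF.
have y0 : 0 <= y by rewrite divr_ge0 ?subr_ge0// ltW.
have m0 : 0 < 1 + y by lra.
have SE : S = N * (1 + y) by lra.
have W0 : 0 <= P - N * (1 + y) ^+ 2.
  have := sum_sqr_ge s' (1 + y); rewrite -/P -/S -/N SE; nra.
set Q := \prod_(x <- s') x.
have : N - (N - 1) / N * (P / (1 + y) ^+ 2) <= Q / (1 + y) ^+ n.
  have := IH [seq x / (1 + y) | x <- s'].
  rewrite size_map -/n -/N !big_map -mulr_suml -/S SE mulfK ?gt_eqF// prodf_div.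
  under eq_bigr do rewrite expr_div_n.
  rewrite -mulr_suml big_const_seq count_predT iter_mulr_1; apply => //.
  - by move: sr; rewrite size_s.
  - by rewrite -size_eq0 size_map size_eq0.
  - apply/allP => _ /mapP[x xs ->].
    by rewrite /= divr_ge0 ?(ltW m0)//; exact: (allP s'_ge0).
rewrite ler_pdivlMr ?exprn_gt0// => Qge.
have y1 : y <= 1.
  rewrite /y ler_pdivrMr// mul1r; apply: (@le_trans _ _ 1); first by lra.
  by rewrite ler1n.
have bern : 1 + (1 - b) <= (1 + y) ^+ n.
  by rewrite -yN mulrC bernoulli_ge//; lra.
have bm : b * (1 + y) ^+ n <= 1.
  (* Since [b = 1 - N y <= (1 - y)^N], the product is at most [(1 - y^2)^N]. *)
  apply: (@le_trans _ _ ((1 - y) ^+ n * (1 + y) ^+ n)).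
    rewrite ler_wpM2r ?exprn_ge0 ?(ltW m0)//.
    have := @bernoulli_ge (- y) n; rewrite mulrN -/N [N * y]mulrC yN; lra.
  rewrite -exprMn exprn_ile1//; nra.
have m1 : 1 <= (1 + y) ^+ 2 by nra.
have N1 : 1 <= N by rewrite ler1n.
have Mn0 : 0 < (1 + y) ^+ n by rewrite exprn_gt0.
set M := (1 + y) ^+ n in Qge bern bm Mn0.
set m2 := (1 + y) ^+ 2 in W0 m1 Qge.
(* [W] is [N] times the variance of the remaining numbers. *)
set W := P - N * m2 in W0.
have PE : P = W + N * m2 by rewrite /W; ring.
have {}Qge : M - (N - 1) / N * (M / m2) * W <= Q.
  apply: le_trans Qge; rewrite PE le_eqVlt; apply/orP; left; apply/eqP.
  by field; rewrite !gt_eqF//; lra.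
have bMm : b * (M / m2) <= 1.
  rewrite mulrA ler_pdivrMr; last by lra.
  lra.
have coef : (N - 1) / N <= N / (N + 1).
  by rewrite ler_pdivrMr// mulrAC ler_pdivlMr; nra.
have coef0 : 0 <= (N - 1) / N by rewrite divr_ge0//; lra.
apply: (@le_trans _ _ (b * (M - (N - 1) / N * (M / m2) * W))); last first.
  by rewrite ler_wpM2l.
have : (N - 1) / N * (b * (M / m2)) * W <= N / (N + 1) * W.
  rewrite ler_wpM2r//; apply: le_trans coef.
  by rewrite -[leRHS]mulr1 ler_wpM2l.
have : b * (1 + (1 - b)) <= b * M by rewrite ler_wpM2l.
have -> : N + 1 - 1 = N by ring.
have -> : N / (N + 1) * (b ^+ 2 + P) = N + N / (N + 1) * W + (1 - b) ^+ 2.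
  rewrite PE /m2 (_ : b = 1 - y * N); last by lra.
  by field; rewrite !gt_eqF//; lra.
lra.
Qed.

End MeanInequality.

(** * The cyclic inequality *)

Section CyclicInequality.
Variable R : realType.

(** The numbers [t_i] rescaled to sum [r] have a product [pi] at least [d], by the
    variance bound. As [s0] is at most the sum [T] of the [t_i], the quantity [r D] to
    be bounded is at most [s0^2 d]; and [0 < d <= 1] allows [d^(r + 1)] to be replaced
    by [d^2], hence by [pi^2], which is the product occurring in the hypothesis. *)
Lemma cyclic_core r (t : 'I_r -> R) (s0 X : R) : (0 < r)%N ->
  (forall i, 0 <= t i) -> 0 <= s0 <= \sum_i t i -> 0 <= X ->
  r.+1%:R ^+ r.+1 * r%:R ^+ (2 * r) * (s0 ^+ 2 * \prod_i t i ^+ 2) <= X ^+ r.+1 ->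
  r.+1%:R * (r%:R * (s0 ^+ 2 - (r%:R - 1) * \sum_i t i ^+ 2)) <= X.
Proof.
move=> r0 t0 /andP[s00 s0T] X0 XX.
set T := \sum_i t i in s0T *; set S := \sum_i t i ^+ 2.
have size_ie : size (index_enum 'I_r) = r.
  by rewrite /index_enum unlock -enumT size_enum_ord.
have rR : (0 : R) < r%:R by rewrite ltr0n.
have r1 : (1 : R) <= r%:R by rewrite ler1n.
have S0 : 0 <= S by apply: sumr_ge0 => i _; rewrite sqr_ge0.
have rS0 : 0 <= (r%:R - 1) * S by rewrite mulr_ge0// subr_ge0.
set D := s0 ^+ 2 - _.
have [D0|D0] := lerP D 0.
  by apply: le_trans X0; rewrite mulr_ge0_le0// mulr_ge0_le0// ltW.
have s0_gt0 : 0 < s0.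
  rewrite lt_neqAle s00 andbT; apply/eqP => s0E.
  by move: D0; rewrite /D -s0E expr0n /=; lra.
have T0 : 0 < T by exact: lt_le_trans s0T.
(* The bound of [prod_ge_variance] for the numbers [t_i r / T]. *)
pose d := r%:R * (T ^+ 2 - (r%:R - 1) * S) / T ^+ 2.
pose pi := \prod_i (t i * (r%:R / T)).
have piE : pi = (\prod_i t i) * (r%:R / T) ^+ r.
  by rewrite /pi big_split /= prodr_const card_ord.
have dpi : d <= pi.
  have := @prod_ge_variance _ [seq t i * (r%:R / T) | i <- index_enum 'I_r].
  rewrite !big_map size_map size_ie.
  have -> : \sum_i (t i * (r%:R / T)) ^+ 2 = S * (r%:R / T) ^+ 2.
    by rewrite mulr_suml; apply: eq_bigr => i _; rewrite exprMn.
  rewrite -mulr_suml -/T => h.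
  have -> : d = r%:R - (r%:R - 1) / r%:R * (S * (r%:R / T) ^+ 2).
    by rewrite /d; field; rewrite !gt_eqF.
  apply: h.
  - by rewrite -size_eq0 size_map size_ie -lt0n.
  - by apply/allP => _ /mapP[i _ ->]; rewrite /= mulr_ge0// divr_ge0// ltW.
  - by rewrite mulrCA divff ?mulr1 ?gt_eqF.
have d1 : d <= 1.
  rewrite ler_pdivrMr ?exprn_gt0// mul1r.
  have := @sum_sqr_ge _ [seq t i | i <- index_enum 'I_r] (T / r%:R).
  rewrite !big_map size_map size_ie.
  rewrite -/T -/S.
  have -> : 2 * (T / r%:R) * T - r%:R * (T / r%:R) ^+ 2 = T ^+ 2 / r%:R.
    by field; rewrite gt_eqF.
  rewrite ler_pdivrMr// => TS.
  have : (r%:R - 1) * T ^+ 2 <= (r%:R - 1) * (S * r%:R) by rewrite ler_wpM2l//; lra.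
  lra.
have rDd : r%:R * D <= s0 ^+ 2 * d.
  have T2 : 0 < T ^+ 2 by rewrite exprn_gt0.
  have sT2 : s0 ^+ 2 <= T ^+ 2 by rewrite lerXn2r ?nnegrE// ltW.
  rewrite /d mulrA ler_pdivlMr// /D.
  rewrite [leRHS](_ : _ = r%:R * (s0 ^+ 2 * (T ^+ 2 - (r%:R - 1) * S))); last by ring.
  rewrite -mulrA ler_pM2l//.
  have : s0 ^+ 2 * ((r%:R - 1) * S) <= T ^+ 2 * ((r%:R - 1) * S) by rewrite ler_wpM2r.
  lra.
have rD0 : 0 < r%:R * D by rewrite mulr_gt0.
have d0 : 0 < d.
  by have := lt_le_trans rD0 rDd; rewrite pmulr_rgt0// exprn_gt0.
rewrite -(@ler_pXn2r _ r.+1)// ?nnegrE//; last by rewrite mulr_ge0// ltW.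
apply: le_trans XX; rewrite exprMn -mulrA ler_pM2l ?exprn_gt0 ?ltr0n//.
apply: (@le_trans _ _ ((s0 ^+ 2 * d) ^+ r.+1)).
  by rewrite lerXn2r// nnegrE ltW// (lt_le_trans rD0).
have -> : r%:R ^+ (2 * r) * (s0 ^+ 2 * \prod_i t i ^+ 2)
    = s0 ^+ 2 * ((T ^+ 2) ^+ r * pi ^+ 2).
  have -> : r%:R ^+ (2 * r) = (T ^+ 2) ^+ r * ((r%:R / T) ^+ r) ^+ 2.
    by rewrite exprM (exprAC (r%:R / T)) -!exprMn [T * _]mulrC divfK ?gt_eqF.
  by rewrite piE prodrXl; ring.
rewrite exprMn exprS -mulrA ler_pM2l ?exprn_gt0//.
apply: ler_pM; rewrite ?exprn_ge0 ?(ltW d0)//.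
  by rewrite lerXn2r ?nnegrE ?exprn_ge0 ?ler_sqr ?nnegrE// ltW.
apply: (@le_trans _ _ (d ^+ 2)); last by rewrite lerXn2r ?nnegrE ?(le_trans _ dpi)// ltW.
by rewrite (@ler_wiXn2l _ d)// ltW.
Qed.

(** In the geometric mean the cyclic shift of [a] disappears. *)
Lemma cyclic_AGM n (c a b : 'I_n -> R) :
  (forall i, 0 <= c i) -> (forall i, 0 <= a i) -> (forall i, 0 <= b i) ->
  n%:R ^+ n * (\prod_i c i * \prod_i (a i * b i))
    <= (\sum_i c i * a (ordS i) * b i) ^+ n.
Proof.
move=> c0 a0 b0.
have := @leif_AGM_scaled _ 'I_n predT (fun i => c i * a (ordS i) * b i).
rewrite card_ord => /(_ _)[|+ _]; first by move=> i _; rewrite mulrn_wge0// !mulr_ge0.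
apply: le_trans; rewrite prodrMn_const card_ord -[leRHS]mulr_natl natrX.
rewrite ler_wpM2l ?exprn_ge0// !big_split/= mulrA.
by rewrite [X in _ * X * _ <= _](reindex_inj (@ordS_inj n)).
Qed.

(** Here [a], [b] stand for the diagonals of two positive matrices with product
    zero and [u l m] for the scalar product of their entries at [(l, m)]: the minors
    bound [u l m ^ 2], and the diagonal of the product gives the vanishing row sums.
    Put [s_l ^ 2 = u l l]. The row sums turn all off-diagonal terms into the [s_l],
    and what is left to prove is
    [sum c_l a_(l+1) b_l >= n (n - 1) (s_0 ^ 2 - (n - 2) sum_(l > 0) s_l ^ 2)]. Row
    zero gives [s_0 <= sum_(l > 0) s_l], and the arithmetic-geometric inequality bounds
    the left side below by the product of all [s_l ^ 2]. *)
Lemma cyclic_inequality n (a b : 'I_n -> R) (u : 'I_n -> 'I_n -> R) :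
  (1 < n)%N -> (forall l, 0 <= a l) -> (forall l, 0 <= b l) ->
  (forall l, u l l = a l * b l) -> (forall l m, u l m = u m l) ->
  (forall l m, u l m ^+ 2 <= u l l * u m m) -> (forall l, \sum_m u l m = 0) ->
  0 <= \sum_(l < n) \sum_(m < n)
    if l == m then
      (if l == 0%N :> nat then 1 else (n%:R - 1) ^+ 2) * (a (ordS l) - a l) * b l
    else (if (l == 0%N :> nat) || (m == 0%N :> nat)
          then - pcoef R n else - qcoef R n) * u l m.
Proof.
case: n a b u => [//|r] a b u; rewrite ltnS => r0 a0 b0 uE usym umin usum.
pose c (l : 'I_r.+1) : R := if l == 0%N :> nat then 1 else (r.+1%:R - 1) ^+ 2.
pose s l := Num.sqrt (a l * b l).
have s0 l : 0 <= s l by rewrite sqrtr_ge0.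
have sE l : s l ^+ 2 = u l l by rewrite sqr_sqrtr ?mulr_ge0// uE.
have us l m : `|u l m| <= s l * s m.
  rewrite -[leRHS]ger0_norm ?mulr_ge0// -ler_sqr ?nnegrE ?mulr_ge0//.
  by rewrite !real_normK ?num_real// [leRHS]exprMn !sE.
have rE : r.+1%:R - 1 = r%:R :> R by rewrite -natr1 addrK.
pose X := \sum_l c l * a (ordS l) * b l.
have c0 l : 0 <= c l by rewrite /c; case: ifP => // _; rewrite sqr_ge0.
have X0 : 0 <= X by apply: sumr_ge0 => l _; rewrite !mulr_ge0.
pose D := s ord0 ^+ 2 - (r%:R - 1) * \sum_(i < r) s (lift ord0 i) ^+ 2.
have XD : r.+1%:R * (r%:R * D) <= X.
  apply: cyclic_core => //; last first.
    apply: le_trans (cyclic_AGM c0 a0 b0).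
    rewrite -mulrA ler_wpM2l ?exprn_ge0// !big_ord_recl /= /c/= mul1r rE.
    rewrite big_const_ord iter_mulr_1 -exprM ler_wpM2l ?exprn_ge0//.
    rewrite sE uE ler_wpM2l ?mulr_ge0//.
    by rewrite le_eqVlt; apply/orP; left; apply/eqP; apply: eq_bigr => i _; rewrite sE uE.
  rewrite s0 /=; have [->|s00] := eqVneq (s ord0) 0; first exact: sumr_ge0.
  have s0_gt0 : 0 < s ord0 by rewrite lt_def s00 s0.
  rewrite -(ler_pM2l s0_gt0) -expr2 sE mulr_sumr.
  have := usum ord0; rewrite big_ord_recl => /eqP; rewrite addr_eq0 => /eqP ->.
  rewrite -sumrN ler_sum// => i _.
  by apply: le_trans (us _ _); rewrite -normrN ler_norm.
rewrite [leRHS](_ : _ = X - r.+1%:R * (r%:R * D)); first by rewrite subr_ge0.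
pose S := \sum_(i < r) s (lift ord0 i) ^+ 2.
have row0 : \sum_(i < r) u ord0 (lift ord0 i) = - s ord0 ^+ 2.
  by have := usum ord0; rewrite big_ord_recl -sE => /eqP; rewrite addrC addr_eq0 => /eqP.
have rows : \sum_(i < r) \sum_(j < r | j != i) u (lift ord0 i) (lift ord0 j)
    = s ord0 ^+ 2 - S.
  rewrite -[s ord0 ^+ 2]opprK -row0 -sumrN /S -sumrB; apply: eq_bigr => i _.
  have := usum (lift ord0 i); rewrite big_ord_recl (bigD1 i)//= sE [u _ ord0]usym.
  by lra.
transitivity (X - \sum_l c l * u l l
  - pcoef R r.+1 * (2 * \sum_(i < r) u ord0 (lift ord0 i))
  - qcoef R r.+1 * (\sum_(i < r) \sum_(j < r | j != i) u (lift ord0 i) (lift ord0 j))).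
  have rowE (i : 'I_r) : \sum_(m < r.+1)
      (if lift ord0 i == m then c (lift ord0 i)
           * (a (ordS (lift ord0 i)) - a (lift ord0 i)) * b (lift ord0 i)
       else (if (lift ord0 i == 0%N :> nat) || (m == 0%N :> nat)
             then - pcoef R r.+1 else - qcoef R r.+1) * u (lift ord0 i) m)
     = (c (lift ord0 i) * a (ordS (lift ord0 i)) * b (lift ord0 i)
       - c (lift ord0 i) * u (lift ord0 i) (lift ord0 i))
       - pcoef R r.+1 * u ord0 (lift ord0 i)
       - qcoef R r.+1 * \sum_(j < r | j != i) u (lift ord0 i) (lift ord0 j).
    rewrite big_ord_recl (bigD1 i)//= eqxx [u (lift _ _) ord0]usym uE.
    rewrite mulr_sumr -sumrN addrCA !addrA; congr (_ + _); first by ring.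
    by apply: eq_bigr => j ji; rewrite (inj_eq lift_inj) eq_sym (negPf ji) mulNr.
  rewrite big_ord_recl (eq_bigr _ (fun i _ => rowE i)) !big_split/= !sumrN -!mulr_sumr.
  have -> : \sum_(m < r.+1)
      (if ord0 == m then c ord0 * (a (ordS ord0) - a ord0) * b ord0
       else - pcoef R r.+1 * u ord0 m)
     = c ord0 * (a (ordS ord0) - a ord0) * b ord0
       - pcoef R r.+1 * \sum_(i < r) u ord0 (lift ord0 i).
    rewrite big_ord_recl eqxx mulr_sumr -sumrN; congr (_ + _).
    by apply: eq_bigr => i _; rewrite mulNr.
  rewrite /X !big_ord_recl /= uE /c /= -!mulr_sumr.
  by ring.
rewrite row0 rows big_ord_recl /c/= -sE rE -mulr_sumr.
rewrite (eq_bigr (fun i => s (lift ord0 i) ^+ 2)); last by move=> i _; rewrite sE.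
rewrite /D -/S /pcoef /qcoef -!natr1.
by field.
Qed.

End CyclicInequality.

(** * Cross-positivity of the generator *)

Section OuterProducts.
Variables (R : realType) (k n : nat).
Local Notation O := (cayley_dickson R k).
Local Notation M := (cdmx R k n).
Local Notation H := (herm_mx R k n).
Implicit Types (X Y Z : M) (v : 'I_n -> O).

Lemma cd_cauchy_schwarz (x y : O) : cd_ip x y ^+ 2 <= cd_ip x x * cd_ip y y.
Proof.
have [->|y0] := eqVneq y 0; first by rewrite !cd_ip0r expr0n mulr0.
have := cd_ip_ge0 (cd_ip y y *: x - cd_ip x y *: y).
rewrite !(cd_ipDr, cd_ipNr, cd_ipZr, cd_ipDl, cd_ipNl, cd_ipZl) [cd_ip y x]cd_ipC.
rewrite (_ : _ + _ = cd_ip y y * (cd_ip x x * cd_ip y y - cd_ip x y ^+ 2)).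
  by rewrite pmulr_rge0 ?cd_ip_gt0// subr_ge0.
ring.
Qed.

Definition outer v : M := [ffun ij => cd_mul (v ij.1) (cd_conj (v ij.2))].

Lemma outer_herm v : outer v \in H.
Proof. by apply/herm_mxP/ffunP => -[i j]; rewrite !ffunE cd_conjM cd_conjK. Qed.

(** The associativity needed for the square of [outer v] to be a multiple of
    [outer v]. It fails for general octonionic vectors. *)
Definition coherent v := forall i p j,
  cd_mul (cd_mul (v i) (cd_conj (v p))) (cd_mul (v p) (cd_conj (v j)))
    = cd_ip (v p) (v p) *: cd_mul (v i) (cd_conj (v j)).

(** The square of [outer v] is [N] times [outer v], with [N] the squared norm of
    [v]; so [outer v] is the square of its multiple by [N^(-1/2)]. *)
Lemma outer_psd v : coherent v -> psd_cone R k n (vsproj H (outer v)).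
Proof.
move=> coh; set N := \sum_p cd_ip (v p) (v p).
have N0 : 0 <= N by apply: sumr_ge0 => p _; exact: cd_ip_ge0.
have sqr : jordan_mul (outer v) (outer v) = N *: outer v.
  rewrite jordan_mul_sqr; apply/ffunP => -[i j]; rewrite !ffunE scaler_suml.
  by apply: eq_bigr => p _; rewrite !ffunE /= coh.
exists ((Num.sqrt N)^-1 *: vsproj H (outer v)).
have jZ a X Y : jordan_mul (a *: X) Y = a *: jordan_mul X Y.
  by rewrite ![jordan_mul _ Y]jordan_mulC linearZ.
rewrite linearZ /= vsprojK ?outer_herm// jZ linearZ /= sqr !scalerA.
have [N_eq0|N_neq0] := eqVneq N 0; last first.
  by rewrite -invfM -expr2 sqr_sqrtr// mulVf// scale1r.
have v0 p : v p = 0.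
  apply/eqP; apply: contraT => /cd_ip_gt0.
  by rewrite (psumr_eq0P _ N_eq0) ?ltxx// => i _; exact: cd_ip_ge0.
by rewrite N_eq0 mulr0 scale0r; apply/ffunP => ij; rewrite !ffunE v0 cd_mul0l.
Qed.

Lemma coherent_real (x : 'I_n -> R) : coherent (fun i => x i *: cd_one R k).
Proof.
move=> i p j; rewrite !cd_conjZ !cd_conj_one.
rewrite !(cd_mulZl, cd_mulZr, cd_mul1l, cd_ipZl, cd_ipZr) cd_ip_one !scalerA.
by congr (_ *: _); ring.
Qed.

(** The vectors that see the minor of order two on the rows [l] and [m]. *)
Definition support2 l m (t : R) (b : O) (i : 'I_n) : O :=
  if i == l then t *: cd_one R k else if i == m then b else 0.

(** Only one entry is not real, and an alternative algebra is associative on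
    products of an element, its conjugate and reals. *)
Lemma coherent_support2 l m t b : cd_alternative R k -> coherent (support2 l m t b).
Proof.
move=> alt.
have altl (x y : O) : cd_mul (cd_conj x) (cd_mul x y) = cd_ip x x *: y := (alt x y).1.
have altr (x y : O) : cd_mul (cd_mul y (cd_conj x)) x = cd_ip x x *: y.
  by have := (alt (cd_conj x) y).2; rewrite cd_conjK cd_ip_conj.
have conjR (a : R) : cd_conj (a *: cd_one R k) = a *: cd_one R k :> O.
  by rewrite cd_conjZ cd_conj_one.
have mulRl a (x : O) : cd_mul (a *: cd_one R k) x = a *: x by rewrite cd_mulZl cd_mul1l.
have mulRr a (x : O) : cd_mul x (a *: cd_one R k) = a *: x by rewrite cd_mulZr cd_mul1r.
have vE i : (exists a, support2 l m t b i = a *: cd_one R k)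
    \/ support2 l m t b i = b.
  rewrite /support2; case: eqP => _; first by left; exists t.
  by case: eqP => _; [right|left; exists 0; rewrite scale0r].
move=> i p j.
case: (vE p) => [[ap ->]|->].
  rewrite conjR mulRl mulRr cd_mulZl cd_mulZr scalerA cd_ipZl cd_ipZr cd_ip_one.
  by rewrite mulr1.
case: (vE i) => [[ai ->]|->].
  by rewrite !mulRl cd_mulZl altl !scalerA mulrC.
case: (vE j) => [[aj ->]|->].
  by rewrite conjR !mulRr cd_mulZr altr !scalerA mulrC.
by rewrite (cd_mul_conj b).1 cd_mulZl cd_mul1l.
Qed.

Lemma mxip_support2 Z l m t b : Z \in H -> l != m ->
  mxip Z (outer (support2 l m t b)) =
    t ^+ 2 * cd_ip (Z (l, l)) (cd_one R k) + 2 * t * cd_ip (Z (l, m)) (cd_conj b)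
    + cd_ip b b * cd_ip (Z (m, m)) (cd_one R k).
Proof.
move=> ZH lm.
have sl : support2 l m t b l = t *: cd_one R k by rewrite /support2 eqxx.
have sm : support2 l m t b m = b by rewrite /support2 eq_sym (negPf lm) eqxx.
have s0 i : (i != l) && (i != m) -> support2 l m t b i = 0.
  by rewrite /support2 => /andP[/negPf -> /negPf ->].
have row i : \sum_j cd_ip (Z (i, j)) (outer (support2 l m t b) (i, j))
    = cd_ip (Z (i, l)) (outer (support2 l m t b) (i, l))
      + cd_ip (Z (i, m)) (outer (support2 l m t b) (i, m)).
  rewrite (bigD1 l)//= (bigD1 m) 1?eq_sym//= big1 ?addr0// => j /s0 vj.
  by rewrite ffunE /= vj linear0 cd_mul0r cd_ip0r.
rewrite /mxip (eq_bigr _ (fun i _ => row i)) (bigD1 l)//= (bigD1 m) 1?eq_sym//=.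
rewrite big1 => [|i /s0 vi]; last by rewrite !ffunE /= vi !cd_mul0l !cd_ip0r addr0.
rewrite !ffunE /= sl sm cd_conjZ cd_conj_one (cd_mul_conj b).1.
rewrite !(cd_mulZl, cd_mulZr, cd_mul1l, cd_mul1r, cd_ipZr).
have -> : cd_ip (Z (m, l)) b = cd_ip (Z (l, m)) (cd_conj b).
  by rewrite -(hermE l m)// cd_ip_conj_l.
ring.
Qed.

Lemma mxip_real Z (x : 'I_n -> R) : mxip Z (outer (fun i => x i *: cd_one R k)) =
  \sum_i \sum_j x i * x j * cd_ip (Z (i, j)) (cd_one R k).
Proof.
apply: eq_bigr => i _; apply: eq_bigr => j _.
rewrite ffunE /= cd_conjZ cd_conj_one cd_mulZl cd_mulZr cd_mul1l !cd_ipZr; ring.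
Qed.

End OuterProducts.

Section CrossPositivity.
Variables (R : realType) (k n : nat).
Hypotheses (hk : (k <= 3)%N) (hO : k = 3%N -> n = 3%N).
Local Notation H := (herm_mx R k n).
Let law := herm_jordan_law (R := R) hk hO.
Local Notation J := (herm_euclidean_jordan law).
Implicit Types (z f : subvs_of H).

Lemma psd_outer_ge0 z v : psd_cone R k n z -> coherent v ->
  0 <= mxip (vsval z) (outer v).
Proof.
move=> /(psd_cone_dual law) psdz /outer_psd/psd_coneP[y yE].
by have := psdz y; rewrite -yE /herm_ip vsprojK// outer_herm.
Qed.

Lemma psd_diag_ge0 z l : psd_cone R k n z -> 0 <= cd_ip (vsval z (l, l)) (cd_one R k).
Proof.
move=> psdz.
have := psd_outer_ge0 psdz (@coherent_real R k n (fun i => (i == l)%:R)).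
rewrite mxip_real (bigD1 l)//= (bigD1 l)//= eqxx.
rewrite big1 => [|j /negPf ->]; last by rewrite mulr0 mul0r.
rewrite big1 => [|i /negPf il]; last by rewrite big1// => j _; rewrite il !mul0r.
by rewrite !addr0 !mul1r.
Qed.

(** Positivity of the quadratic polynomial in [t] obtained by pairing with the
    vectors supported on [l] and [m]: its discriminant is the minor. *)
Lemma psd_minor z l m : psd_cone R k n z ->
  cd_ip (vsval z (l, m)) (vsval z (l, m))
    <= cd_ip (vsval z (l, l)) (cd_one R k) * cd_ip (vsval z (m, m)) (cd_one R k).
Proof.
move=> psdz; have [<-|lm] := eqVneq l m; first by rewrite cd_ip_diag ?subvsP.
have alt := cd_alternative_le3 (R := R) hk.
set N := cd_ip _ (vsval z (l, m)).
have := psd_diag_ge0 l psdz; have := psd_diag_ge0 m psdz.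
set zm := cd_ip _ _; set zl := cd_ip _ _ => zm0 zl0.
have test t : 0 <= t ^+ 2 * zl - 2 * t * N + N * zm.
  have := psd_outer_ge0 psdz
    (coherent_support2 l m t (- cd_conj (vsval z (l, m))) alt).
  rewrite mxip_support2 ?subvsP// linearN /= cd_conjK cd_ipNr cd_ipNl cd_ipNr.
  by rewrite opprK cd_ip_conj -/N -/zm -/zl; lra.
have N0 : 0 <= N by exact: cd_ip_ge0.
have [zl_eq0|zl_neq0] := eqVneq zl 0.
  (* The polynomial is now affine, with slope [- 2 N]. *)
  by have := test (zm + 1); rewrite zl_eq0; nra.
have zl_gt0 : 0 < zl by rewrite lt_def zl_neq0.
(* The vertex of the parabola. *)
have := test (N / zl).
rewrite (_ : _ + _ = N / zl * (zl * zm - N)); last by field.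
have [->|N_neq0] := eqVneq N 0; first by move=> _; rewrite mulr_ge0.
by rewrite pmulr_rge0 ?subr_ge0// divr_gt0// lt_def N_neq0.
Qed.

(** All entries of the matrices enter through the numbers [u l m] and the two
    diagonals, so the claim is the cyclic inequality. *)
Lemma genB_cross_positive z f : (1 < n)%N ->
  psd_cone R k n z -> psd_cone R k n f -> herm_mul z f = 0 ->
  0 <= herm_ip (genB R k n z) f.
Proof.
move=> n1 psdz psdf zf0.
set a := fun l => cd_ip (vsval z (l, l)) (cd_one R k).
set b := fun l => cd_ip (vsval f (l, l)) (cd_one R k).
pose u l m := cd_ip (vsval z (l, m)) (vsval f (l, m)).
have zH := subvsP z; have fH := subvsP f.
have uE l : u l l = a l * b l by rewrite /u cd_ip_diag.
have usym l m : u l m = u m l.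
  by rewrite /u -(hermE l m zH) -(hermE l m fH) cd_ip_conj.
have umin l m : u l m ^+ 2 <= u l l * u m m.
  rewrite !uE mulrACA; apply: le_trans (cd_cauchy_schwarz _ _) _.
  by apply: ler_pM; rewrite ?cd_ip_ge0 ?psd_minor.
have usum l : \sum_m u l m = 0.
  by rewrite -jordan_mul_diag// -herm_mulE zf0 linear0 ffunE cd_ipC cd_ip0r.
have := cyclic_inequality n1 (fun l => psd_diag_ge0 l psdz)
  (fun l => psd_diag_ge0 l psdf) uE usym umin usum.
congr (_ <= _); rewrite /herm_ip genBE; apply: eq_bigr => l _; apply: eq_bigr => m _.
rewrite ffunE /=; have [<-|lm] := eqVneq l m.
  have E j : cd_ip (vsval z (j, j)) (vsval f (l, l)) = a j * b l.
    rewrite {1}(herm_diagE j zH) {1}(herm_diagE l fH) cd_ipZl cd_ipZr cd_ip_one.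
    by rewrite mulr1.
  by rewrite cd_ipZl cd_ipDl cd_ipNl !E -mulrBl mulrA.
have [lm'|ml|/val_inj lm'] := ltngtP l m; last by rewrite lm' eqxx in lm.
  by rewrite cd_ipZl [m == _ :> nat]gtn_eqF ?orbF// (leq_trans _ lm').
rewrite cd_ipZl -/(u _ _) [l == _ :> nat]gtn_eqF ?(leq_trans _ ml)//=.
by rewrite (hermE m l zH).
Qed.

End CrossPositivity.

(** * The biquadratic form of the generator *)

Section CyclicForm.
Variable R : realType.

Definition diag_rate n (l : 'I_n) : R := if l == 0%N :> nat then 1 else (n%:R - 1) ^+ 2.

(** The rate at which the generator damps the entry at [(l, m)]. It is set to
    zero on the diagonal so that sums can run over all pairs. *)
Definition off_rate n (l m : 'I_n) : R :=
  if l == m then 0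
  else if (l == 0%N :> nat) || (m == 0%N :> nat) then pcoef R n else qcoef R n.

(** The pairing of the image of [v v^T] under the generator with [w w^T]. *)
Definition cyclic_form n (v w : 'I_n -> R) : R :=
  \sum_l diag_rate l * (v (ordS l) ^+ 2 - v l ^+ 2) * w l ^+ 2
  - \sum_l \sum_m off_rate l m * (v l * w l) * (v m * w m).

Lemma quadratic_ge0_slope (a b : R) : (forall s, 0 <= a * s + b * s ^+ 2) -> a = 0.
Proof.
move=> h; have b0 : 0 <= b by have := h 1; have := h (-1); lra.
have := h (- a / (b + 1)).
have -> : a * (- a / (b + 1)) + b * (- a / (b + 1)) ^+ 2 = - (a / (b + 1)) ^+ 2.
  by field; rewrite gt_eqF//; lra.
rewrite oppr_ge0 => /(conj (sqr_ge0 _))/andP/le_anti/esym/eqP.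
by rewrite sqrf_eq0 mulf_eq0 invr_eq0 (gt_eqF (_ : 0 < b + 1)) ?orbF => [/eqP|]; last lra.
Qed.

Lemma off_rate_sum r (u : 'I_r.+1 -> R) :
  \sum_l \sum_m off_rate l m * u l * u m
  = 2 * pcoef R r.+1 * u ord0 * (\sum_i u (lift ord0 i))
    + qcoef R r.+1 * ((\sum_i u (lift ord0 i)) ^+ 2 - \sum_i u (lift ord0 i) ^+ 2).
Proof.
set U := \sum_i u _.
have row (i : 'I_r) : \sum_m off_rate (lift ord0 i) m * u (lift ord0 i) * u m
    = pcoef R r.+1 * u ord0 * u (lift ord0 i)
      + qcoef R r.+1 * (u (lift ord0 i) * U - u (lift ord0 i) ^+ 2).
  rewrite big_ord_recl /U [\sum_i u (lift ord0 i)](bigD1 i)//= (bigD1 i)//= {1 2}/off_rate /= eqxx.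
  rewrite [X in _ + (_ + X)](eq_bigr
    (fun j => qcoef R r.+1 * u (lift ord0 i) * u (lift ord0 j))); last first.
    by move=> j ji; rewrite /off_rate (inj_eq lift_inj) eq_sym (negPf ji).
  rewrite -mulr_sumr; ring.
rewrite big_ord_recl (eq_bigr _ (fun i _ => row i)) big_ord_recl {1}/off_rate eqxx.
rewrite (eq_bigr (fun i => pcoef R r.+1 * u ord0 * u (lift ord0 i)))//.
rewrite big_split/= -!mulr_sumr sumrB -mulr_suml -/U; ring.
Qed.

(** The form depends on [v] and [w] through the products [u_i = v_i w_i], which are
    kept fixed, and through the cyclic terms [(v_(l+1) / v_l)^2 u_l^2]. When
    [u_j = 0] the cycle may be cut at [j]: with [v_i = e^(d i)], [d] growing by one
    at each step of the resulting chain, all cyclic terms are of order [e^2]. *)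
Lemma chain_limit n (u : 'I_n -> R) (h : 'I_n -> R) j : u j = 0 ->
  (forall v w : 'I_n -> R,
     0 <= cyclic_form v w + (\sum_i v i * w i) * (\sum_i h i * (v i * w i))) ->
  0 <= - \sum_l diag_rate l * u l ^+ 2 - \sum_l \sum_m off_rate l m * u l * u m
       + (\sum_i u i) * (\sum_i h i * u i).
Proof.
move=> uj0 form_ge0.
(* Numbers the cycle starting just after [j] and ending at [j]. *)
pose d (i : 'I_n) : nat := if (j < i)%N then val i else (i + n)%N.
have dS (l : 'I_n) : l != j -> d (ordS l) = (d l).+1.
  rewrite -val_eqE /= /d /= => lj; have ln := ltn_ord l; have jn := ltn_ord j.
  have [lS|lS] := ltnP l.+1 n.
    rewrite modn_small//; case: (ltngtP j l) lj => // jl _.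
      by rewrite ltnS (ltnW jl).
    by rewrite ltnNge jl.
  have -> : l.+1 = n by apply/eqP; rewrite eqn_leq ln.
  have jl : (j < l)%N by rewrite ltn_neqAle eq_sym lj -ltnS (leq_trans jn).
  by rewrite modnn jl ltn0 add0n; apply/eqP; rewrite eqn_leq ln andbT.
set Q := (X in 0 <= X).
pose C := \sum_l diag_rate l * u l ^+ 2.
suff lim e : 0 < e -> 0 <= e ^+ 2 * C + Q.
  have C0 : 0 <= C.
    apply: sumr_ge0 => l _; rewrite mulr_ge0 ?sqr_ge0// /diag_rate.
    by case: ifP => // _; exact: sqr_ge0.
  rewrite leNgt; apply/negP => Q0.
  (* Small enough for [e^2 C] to be less than [- Q]. *)
  pose e := Num.min 1 (- Q / (2 * (C + 1))).
  have e0 : 0 < e by rewrite lt_min ltr01 divr_gt0//; lra.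
  have e_le1 : e <= 1 by rewrite /e ge_min lexx.
  have e1 : e ^+ 2 <= e by nra.
  have eQ : e * (2 * (C + 1)) <= - Q.
    by rewrite -ler_pdivlMr; [rewrite /e ge_min lexx orbT|lra].
  have := lim e e0; have := ler_wpM2r C0 e1; nra.
move=> e0; have en0 : e != 0 by rewrite gt_eqF.
have := form_ge0 (fun i => e ^+ d i) (fun i => u i / e ^+ d i).
have uE i : e ^+ d i * (u i / e ^+ d i) = u i by rewrite mulrC divfK// expf_neq0.
rewrite /cyclic_form.
under [in X in _ - X]eq_bigr => l _ do under eq_bigr => m _ do rewrite !uE.
rewrite (eq_bigr _ (fun i _ => uE i)).
under [X in _ + _ * X]eq_bigr => l _ do rewrite uE.
rewrite (_ : \sum_l diag_rate l * _ * _ = e ^+ 2 * C - C); last first.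
  rewrite mulr_sumr -sumrB; apply: eq_bigr => l _.
  have [->|lj] := eqVneq l j; first by rewrite uj0; ring.
  have := expf_neq0 (d l) en0; rewrite dS// (exprS e (d l)); set x := e ^+ d l => x0.
  by field.
by move=> h0; apply: le_trans h0 _; rewrite /Q -/C; lra.
Qed.

(** The form vanishes at [v = 1], [w = (n - 1, -1, ..., -1)], where [sum u = 0],
    so its derivative in the direction that changes [w_0] is zero: this
    determines the sum of the [h_i] over [i > 0] in terms of [h_0]. The limit form of
    [chain_limit] vanishes at [w = (n - 2, -1, ..., 0, ..., -1)] with the zero at
    [j]. Averaging over [j] the inequalities nearby and inserting the relation leaves
    a nonzero slope at a zero of a nonnegative function. The coefficients
    [pcoef] and [qcoef] are those for which the form vanishes at both points. *)
Lemma cyclic_form_rigid n (h : 'I_n -> R) : (2 < n)%N ->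
  ~ (forall v w : 'I_n -> R,
     0 <= cyclic_form v w + (\sum_i v i * w i) * (\sum_i h i * (v i * w i))).
Proof.
case: n h => [//|r] h; rewrite ltnS => r2 form_ge0.
set Hs := \sum_(i < r) h (lift ord0 i).
have rE : r.+1%:R = r%:R + 1 :> R by rewrite -natr1.
have r2R : (2 : R) <= r%:R by rewrite ler_nat.
have sum_const (c : R) : \sum_(i < r) c = r%:R * c.
  by rewrite sumr_const card_ord mulr_natl.
have form1 (w : 'I_r.+1 -> R) :
    0 <= - \sum_l \sum_m off_rate l m * w l * w m + (\sum_i w i) * (\sum_i h i * w i).
  have := form_ge0 (fun=> 1) w; rewrite /cyclic_form.
  rewrite big1 => [|l _]; last by rewrite subrr mulr0 mul0r.
  under [in X in _ - X]eq_bigr => l _ do under eq_bigr => m _ do rewrite !mul1r.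
  under [X in _ + X * _]eq_bigr => l _ do rewrite mul1r.
  under [X in _ + _ * X]eq_bigr => l _ do rewrite mul1r.
  by rewrite sub0r.
(* The relation on [h], from the pencil [w = (r + s, -1, ..., -1)]. *)
have slope1 : 2 * pcoef R r.+1 * r%:R + r%:R * h ord0 - Hs = 0.
  apply: (@quadratic_ge0_slope _ (h ord0)) => s.
  pose w (i : 'I_r.+1) : R := if i == ord0 then r%:R + s else -1.
  have S1 : \sum_(i < r) w (lift ord0 i) = - r%:R.
    by rewrite (eq_bigr (fun=> -1))// sum_const mulrN1.
  have S2 : \sum_(i < r) w (lift ord0 i) ^+ 2 = r%:R.
    by rewrite (eq_bigr (fun=> (-1) ^+ 2))// sum_const sqrrN expr1n mulr1.
  have S3 : \sum_(i < r) h (lift ord0 i) * w (lift ord0 i) = - Hs.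
    by rewrite (eq_bigr (fun i => h (lift ord0 i) * -1))// -mulr_suml mulrN1.
  have := form1 w; rewrite off_rate_sum !big_ord_recl S1 S2 S3 -[w ord0]/(r%:R + s).
  by rewrite /pcoef /qcoef rE; lra.
have delta (j : 'I_r) (f : 'I_r -> R) : \sum_i (i == j)%:R * f i = f j.
  rewrite (bigD1 j)//= eqxx mul1r big1 ?addr0// => i /negPf ->.
  by rewrite mul0r.
(* The limit form at [u = (r - 1 + s, -1, ..., -1)] with [u_j = 0], without the
   term that contains [h_j]; by symmetry it does not depend on [j]. *)
pose P s : R := - ((r%:R - 1 + s) ^+ 2 + r%:R ^+ 2 * (r%:R - 1))
  - (2 * pcoef R r.+1 * (r%:R - 1 + s) * (1 - r%:R)
     + qcoef R r.+1 * ((1 - r%:R) ^+ 2 - (r%:R - 1)))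
  + s * (h ord0 * (r%:R - 1 + s) - Hs).
have test s (j : 'I_r) : 0 <= P s + s * h (lift ord0 j).
  pose w (i : 'I_r.+1) : R :=
    if unlift ord0 i is Some i' then (i' == j)%:R - 1 else r%:R - 1 + s.
  have w0 : w ord0 = r%:R - 1 + s by rewrite /w unlift_none.
  have w1 i : w (lift ord0 i) = (i == j)%:R - 1 by rewrite /w liftK.
  have w1sqr i : w (lift ord0 i) ^+ 2 = 1 - (i == j)%:R.
    by rewrite w1; case: eqP => _ /=; ring.
  have Sd : \sum_(i < r) (i == j)%:R = 1 :> R.
    by rewrite -[RHS](delta j (fun=> 1)); apply: eq_bigr => i _; rewrite mulr1.
  have S1 : \sum_(i < r) w (lift ord0 i) = 1 - r%:R.
    by rewrite (eq_bigr _ (fun i _ => w1 i)) sumrB Sd sum_const mulr1.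
  have S2 : \sum_(i < r) w (lift ord0 i) ^+ 2 = r%:R - 1.
    by rewrite (eq_bigr _ (fun i _ => w1sqr i)) sumrB Sd sum_const mulr1.
  have S3 : \sum_(i < r) h (lift ord0 i) * w (lift ord0 i) = h (lift ord0 j) - Hs.
    rewrite -[X in X - _](delta j (fun i => h (lift ord0 i))) -sumrB.
    by apply: eq_bigr => i _; rewrite w1; ring.
  have S4 : \sum_(i < r) diag_rate (lift ord0 i) * w (lift ord0 i) ^+ 2
      = r%:R ^+ 2 * (r%:R - 1).
    by rewrite -S2 mulr_sumr; apply: eq_bigr => i _; rewrite /diag_rate /= rE addrK.
  have wj : w (lift ord0 j) = 0 by rewrite w1 eqxx subrr.
  have := chain_limit wj form_ge0; rewrite off_rate_sum !big_ord_recl S1 S2 S3 S4 w0.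
  by rewrite /diag_rate /= /P; lra.
have sum_test s : 0 <= r%:R * P s + s * Hs.
  have -> : r%:R * P s + s * Hs = \sum_(j < r) (P s + s * h (lift ord0 j)).
    by rewrite big_split/= sum_const -mulr_sumr.
  by apply: sumr_ge0 => j _; exact: test.
have : - 2 * r%:R * (r%:R - 1) = 0 :> R.
  apply: (@quadratic_ge0_slope _ (r%:R * (h ord0 - 1))) => s.
  have := sum_test s; rewrite /P.
  have HsE : Hs = 2 * pcoef R r.+1 * r%:R + r%:R * h ord0 by lra.
  rewrite HsE /pcoef /qcoef rE; congr (_ <= _).
  by field.
nra.
Qed.

End CyclicForm.

(** * Averaging over sign changes *)

Section SignAverage.
Variables (R : realType) (n : nat).
Implicit Types (v w u : 'I_n -> R) (i j l m : 'I_n).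

Definition quartic (T : 'I_n -> 'I_n -> 'I_n -> 'I_n -> R) v w : R :=
  \sum_i \sum_j \sum_l \sum_m v i * v j * w l * w m * T i j l m.

Definition sgn (theta : {ffun 'I_n -> bool}) i : R := (-1) ^+ theta i.

Lemma sgn_sqr theta i : sgn theta i * sgn theta i = 1.
Proof. by rewrite /sgn -expr2 sqrr_sign. Qed.

(** Every index occurs an even number of times among [i], [j], [l], [m]. *)
Definition paired i j l m :=
  if i == j then l == m else ((l == i) && (m == j)) || ((l == j) && (m == i)).

Definition flip p (theta : {ffun 'I_n -> bool}) : {ffun 'I_n -> bool} :=
  [ffun i => theta i (+) (i == p)].

Lemma flipK p : involutive (flip p).
Proof. by move=> theta; apply/ffunP => i; rewrite !ffunE addbK. Qed.

Lemma sgn_flip p theta i : sgn (flip p theta) i = (-1) ^+ (i == p) * sgn theta i.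
Proof. by rewrite /sgn ffunE signr_addb mulrC. Qed.

(** If some index [p] occurs an odd number of times, changing the sign at [p] is an
    involution that negates the summand. *)
Lemma sign_average i j l m :
  \sum_theta sgn theta i * sgn theta j * sgn theta l * sgn theta m
    = (2 ^ n)%:R * (paired i j l m)%:R.
Proof.
have [pr|npr] := boolP (paired i j l m).
  rewrite (eq_bigr (fun=> 1)) => [|theta _].
    by rewrite sumr_const card_ffun card_bool card_ord mulr1.
  move: pr; rewrite /paired; case: eqP => [<- /eqP <-|_].
    by rewrite sgn_sqr mul1r sgn_sqr.
  have sqr2 : sgn theta i * sgn theta i * (sgn theta j * sgn theta j) = 1.
    by rewrite !sgn_sqr mulr1.
  by case/orP => /andP[/eqP -> /eqP ->]; rewrite -[RHS]sqr2; ring.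
rewrite mulr0.
suff [p odd_p] : exists p, (-1) ^+ (i == p) * (-1) ^+ (j == p) * (-1) ^+ (l == p)
    * (-1) ^+ (m == p) = -1 :> R.
  set S := LHS; suff : S = - S by move=> SE; lra.
  rewrite {1}/S (reindex_inj (inv_inj (@flipK p))) -sumrN.
  apply: eq_bigr => theta _; rewrite -[RHS]mulN1r -[in RHS]odd_p !sgn_flip.
  set a := (-1) ^+ _; set b := (-1) ^+ _; set c := (-1) ^+ _; set d := (-1) ^+ _.
  ring.
move: npr; rewrite /paired.
(* The index [p] is found by comparing the four indices in turn. *)
have [<- lm|ij] := eqVneq i j.
  exists l; rewrite eqxx [m == l]eq_sym (negPf lm).
  by case: (i == l); rewrite ?expr1 ?expr0; ring.
have [<- _|lm] := eqVneq l m.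
  exists i; rewrite eqxx [j == i]eq_sym (negPf ij).
  by case: (l == i); rewrite ?expr1 ?expr0; ring.
have [li|il] := eqVneq i l.
  rewrite -li (negPf ij) orbF /= => mj; exists j.
  by rewrite eqxx (negPf ij) (negPf mj) expr0 expr1; ring.
have [mi|im] := eqVneq i m.
  rewrite -mi /= andbT => lj; exists j.
  by rewrite eqxx (negPf ij) (negPf lj) expr0 expr1; ring.
move=> _; exists i; rewrite eqxx [j == i]eq_sym (negPf ij) [l == i]eq_sym (negPf il).
by rewrite [m == i]eq_sym (negPf im) expr0 expr1; ring.
Qed.

(** The part of the form that survives the average: with [u = v w] it is a
    quadratic form in [u] plus a form in the squares of [v] and [w]. *)
Definition quartic_even (T : 'I_n -> 'I_n -> 'I_n -> 'I_n -> R) v w : R :=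
  \sum_i \sum_l v i ^+ 2 * w l ^+ 2 * T i i l l
  + \sum_i \sum_(j | j != i) v i * w i * (v j * w j) * (T i j i j + T i j j i).

(** The monomials whose indices are not paired cancel. *)
Lemma quartic_average T v w :
  \sum_theta quartic T (fun i => sgn theta i * v i) (fun i => sgn theta i * w i)
    = (2 ^ n)%:R * quartic_even T v w.
Proof.
have swap (F : 'I_n -> 'I_n -> 'I_n -> 'I_n -> {ffun 'I_n -> bool} -> R) :
    \sum_theta \sum_i \sum_j \sum_l \sum_m F i j l m theta
    = \sum_i \sum_j \sum_l \sum_m \sum_theta F i j l m theta.
  rewrite exchange_big; apply: eq_bigr => i _ /=.
  rewrite exchange_big; apply: eq_bigr => j _ /=.
  rewrite exchange_big; apply: eq_bigr => l _ /=.
  by rewrite exchange_big.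
rewrite swap /quartic_even -big_split mulr_sumr; apply: eq_bigr => i _ /=.
have term j l m : \sum_theta sgn theta i * v i * (sgn theta j * v j) * (sgn theta l * w l)
      * (sgn theta m * w m) * T i j l m
    = (2 ^ n)%:R * ((paired i j l m)%:R * (v i * v j * w l * w m * T i j l m)).
  rewrite mulrA -sign_average mulr_suml; apply: eq_bigr => theta _; ring.
under eq_bigr => j _ do under eq_bigr => l _ do under eq_bigr => m _ do rewrite term.
under eq_bigr => j _ do under eq_bigr => l _ do rewrite -mulr_sumr.
under eq_bigr => j _ do rewrite -mulr_sumr.
rewrite -mulr_sumr; congr (_ * _).
have pick (f : 'I_n -> R) p : \sum_m (m == p)%:R * f m = f p.
  rewrite (bigD1 p)//= eqxx mul1r big1 ?addr0// => m /negPf ->.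
  by rewrite mul0r.
rewrite (bigD1 i)//=; congr (_ + _).
  apply: eq_bigr => l _; rewrite /paired eqxx.
  under eq_bigr => m _ do rewrite eq_sym.
  by rewrite pick; ring.
apply: eq_bigr => j ji; rewrite /paired eq_sym (negPf ji).
have split_ind l m : (((l == i) && (m == j)) || ((l == j) && (m == i)))%:R
    = (l == i)%:R * (m == j)%:R + (l == j)%:R * (m == i)%:R :> R.
  have : ~~ ((l == i) && (l == j)).
    by apply/negP => /andP[/eqP -> /eqP ij]; rewrite ij eqxx in ji.
  by case: (l == i); case: (m == j); case: (l == j); case: (m == i) => //= _;
    rewrite ?mulr0 ?mulr1 ?addr0 ?add0r.
under eq_bigr => l _ do under eq_bigr => m _ do
  rewrite split_ind mulrDl -[_ * (m == j)%:R * _]mulrA -[_ * (m == i)%:R * _]mulrA.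
under eq_bigr => l _ do rewrite big_split/= -!mulr_sumr !pick.
by rewrite big_split/= !(pick (fun l => v i * v j * w l * _ * T i j l _)); ring.
Qed.

Lemma cyclic_form_sgn theta v w :
  cyclic_form (fun i => sgn theta i * v i) (fun i => sgn theta i * w i) = cyclic_form v w.
Proof.
have sgn2 i (x : R) : (sgn theta i * x) ^+ 2 = x ^+ 2.
  by rewrite exprMn expr2 sgn_sqr mul1r.
have sgnu i : sgn theta i * v i * (sgn theta i * w i) = v i * w i.
  by rewrite mulrACA sgn_sqr mul1r.
rewrite /cyclic_form; congr (_ - _).
  by apply: eq_bigr => l _; rewrite !sgn2.
by apply: eq_bigr => l _; apply: eq_bigr => m _; rewrite !sgnu.
Qed.

Lemma quartic_even_ge0 T : (forall v w, 0 <= quartic T v w) ->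
  forall v w, 0 <= quartic_even T v w.
Proof.
move=> T0 v w; have n0 : 0 < (2 ^ n)%:R :> R by rewrite ltr0n expn_gt0.
by rewrite -(pmulr_rge0 _ n0) -quartic_average sumr_ge0.
Qed.

(** Sign changes preserve the products [v_i w_i], hence orthogonality, and they
    do not change the cyclic form. *)
Lemma quartic_even_orth T :
  (forall v w, \sum_i v i * w i = 0 -> quartic T v w = cyclic_form v w) ->
  forall v w, \sum_i v i * w i = 0 -> quartic_even T v w = cyclic_form v w.
Proof.
move=> Torth v w vw0; have n0 : (2 ^ n)%:R != 0 :> R by rewrite pnatr_eq0 -lt0n expn_gt0.
apply: (mulfI n0); rewrite -quartic_average.
rewrite (eq_bigr (fun=> cyclic_form v w)) => [|theta _].
  by rewrite sumr_const card_ffun card_bool card_ord mulr_natl.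
rewrite Torth ?cyclic_form_sgn//.
by under eq_bigr => i _ do rewrite mulrACA sgn_sqr mul1r.
Qed.

Lemma delta_sum (f : 'I_n -> R) p : \sum_i (i == p)%:R * f i = f p.
Proof.
rewrite (bigD1 p)//= eqxx mul1r big1 ?addr0// => i /negPf ->.
by rewrite mul0r.
Qed.

(** Evaluating at the differences of two basis vectors gives
    [K i j + K j i = K i i + K j j]. *)
Lemma quadratic_vanish (K : 'I_n -> 'I_n -> R) :
  (forall u, \sum_i u i = 0 -> \sum_i \sum_j K i j * (u i * u j) = 0) ->
  forall u, \sum_i \sum_j K i j * (u i * u j) = (\sum_i u i) * (\sum_i K i i * u i).
Proof.
move=> K0 u.
have Kij i j : K i j + K j i = K i i + K j j.
  have deltaD (f : 'I_n -> R) : \sum_p ((p == i)%:R - (p == j)%:R) * f p = f i - f j.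
    by under eq_bigr => p _ do rewrite mulrBl; rewrite sumrB !delta_sum.
  pose D p : R := (p == i)%:R - (p == j)%:R.
  have D0 : \sum_p D p = 0.
    rewrite -[RHS](subrr (1 : R)) -(deltaD (fun=> 1)).
    by apply: eq_bigr => p _; rewrite mulr1.
  have := K0 D D0.
  rewrite (eq_bigr (fun p => D p * (K p i - K p j))) => [|p _].
    by rewrite (deltaD (fun p => K p i - K p j)); lra.
  rewrite -(deltaD (K p)) mulr_sumr; apply: eq_bigr => q _.
  by rewrite -/(D q); ring.
have sym : 2 * \sum_i \sum_j K i j * (u i * u j)
    = \sum_i \sum_j (K i i + K j j) * (u i * u j).
  rewrite mulr_natl mulr2n {2}exchange_big -big_split; apply: eq_bigr => i _.
  rewrite -big_split; apply: eq_bigr => j _ /=.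
  by rewrite -Kij; ring.
apply: (@mulfI _ 2); first by rewrite pnatr_eq0.
rewrite sym.
have -> : \sum_i \sum_j (K i i + K j j) * (u i * u j)
    = \sum_i \sum_j (K i i * u i * u j) + \sum_i \sum_j (u i * (K j j * u j)).
  rewrite -big_split; apply: eq_bigr => i _; rewrite -big_split; apply: eq_bigr => j _ /=.
  ring.
under eq_bigr => i _ do rewrite -mulr_sumr.
under [X in _ + X]eq_bigr => i _ do rewrite -mulr_sumr.
by rewrite -!mulr_suml; ring.
Qed.

(** Two different basis vectors are orthogonal, which determines the coefficients
    [T p p l l] with [p] different from [l]: they are those of the cyclic form. So
    the even part of [T] and the cyclic form differ by a quadratic form in [u = v w]
    alone, and this vanishes on the hyperplane [sum u = 0]. It is therefore a
    multiple of [sum u]. *)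
Lemma cyclic_form_splitting T : (1 < n)%N ->
  (forall v w, 0 <= quartic T v w) ->
  (forall v w, \sum_i v i * w i = 0 -> quartic T v w = cyclic_form v w) ->
  exists h : 'I_n -> R, forall v w,
    0 <= cyclic_form v w + (\sum_i v i * w i) * (\sum_i h i * (v i * w i)).
Proof.
move=> n1 /quartic_even_ge0 T0 /quartic_even_orth Torth.
have ordS_neq l : ordS l == l = false.
  apply/negbTE; rewrite -val_eqE /=; have ln := ltn_ord l.
  have [lS|lS] := ltnP l.+1 n; first by rewrite modn_small// gtn_eqF.
  have -> : l.+1 = n by apply/eqP; rewrite eqn_leq ln.
  rewrite modnn; apply/eqP => l0; move: lS; rewrite -l0; by rewrite leqNgt n1.
pose h l := T l l l l + diag_rate R l.
have Tdiag p l : T p p l l = diag_rate R l * ((p == ordS l)%:R - (p == l)%:R) + (p == l)%:R * h l.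
  have [->|pl] := eqVneq p l.
    by rewrite [l == _]eq_sym ordS_neq /h /=; ring.
  have vw0 : \sum_i (i == p)%:R * (i == l)%:R = 0 :> R.
    by rewrite delta_sum (negPf pl).
  have uE i : (i == p)%:R * (i == l)%:R = 0 :> R.
    by have [->|] := eqVneq i p; rewrite ?(negPf pl) ?mulr0 ?mul0r.
  have bool_sqr (b : bool) : b%:R ^+ 2 = b%:R :> R by rewrite -natrX; case: b.
  have := Torth (fun i => (i == p)%:R) (fun i => (i == l)%:R) vw0.
  rewrite /quartic_even /cyclic_form.
  rewrite [X in _ + X]big1 => [|i _]; last first.
    by rewrite big1// => j _; rewrite uE !mul0r.
  rewrite [X in _ - X]big1 => [|i _]; last first.
    by rewrite big1// => j _; rewrite uE mulr0 mul0r.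
  rewrite addr0 subr0 (eq_bigr (fun i => (i == p)%:R * T i i l l)) => [|i _].
    rewrite (delta_sum (fun i => T i i l l)) => ->.
    rewrite (eq_bigr (fun i => (i == l)%:R * (diag_rate R i * (ordS i == p)%:R))).
      by rewrite delta_sum [p == _]eq_sym /=; ring.
    move=> i _; rewrite !bool_sqr; have [->|il] := eqVneq i l; last by rewrite /= mulr0 mul0r.
    by rewrite [l == p]eq_sym (negPf pl) /=; ring.
  rewrite bool_sqr -(delta_sum (T i i l)) mulr_sumr; apply: eq_bigr => m _.
  rewrite bool_sqr; have [->|_] := eqVneq m l; last by rewrite /= mulr0 !mul0r mulr0.
  by ring.
pose K i j := if i == j then h i else T i j i j + T i j j i + off_rate R i j.
have even_split v w : quartic_even T v w
    = cyclic_form v w + \sum_i \sum_j K i j * ((v i * w i) * (v j * w j)).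
  have diagE : \sum_i \sum_l v i ^+ 2 * w l ^+ 2 * T i i l l
      = \sum_l diag_rate R l * (v (ordS l) ^+ 2 - v l ^+ 2) * w l ^+ 2
        + \sum_l h l * (v l * w l) ^+ 2.
    rewrite exchange_big -big_split; apply: eq_bigr => l _ /=.
    have := congr2 (fun x y => (diag_rate R l * (x - y) + h l * y) * w l ^+ 2)
      (delta_sum (fun i => v i ^+ 2) (ordS l)) (delta_sum (fun i => v i ^+ 2) l).
    move=> /= E; transitivity ((diag_rate R l * (v (ordS l) ^+ 2 - v l ^+ 2)
      + h l * v l ^+ 2) * w l ^+ 2); last by ring.
    rewrite -E -sumrB !mulr_sumr -big_split mulr_suml; apply: eq_bigr => i _ /=.
    by rewrite Tdiag; ring.
  have rowE i : \sum_j K i j * ((v i * w i) * (v j * w j))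
      = h i * (v i * w i) ^+ 2
        + \sum_(j | j != i) v i * w i * (v j * w j) * (T i j i j + T i j j i)
        + \sum_j off_rate R i j * (v i * w i) * (v j * w j).
    rewrite (bigD1 i)//= [\sum_j off_rate R i j * _ * _](bigD1 i)//= /K /off_rate !eqxx.
    rewrite !mul0r add0r -addrA -big_split/= expr2; congr (_ + _).
    apply: eq_bigr => j ji; rewrite eq_sym (negPf ji); ring.
  rewrite (eq_bigr _ (fun i _ => rowE i)) !big_split/= /quartic_even diagE /cyclic_form.
  ring.
have K0 u : \sum_i u i = 0 -> \sum_i \sum_j K i j * (u i * u j) = 0.
  move=> u0; have := even_split (fun=> 1) u; rewrite Torth; last first.
    by under eq_bigr => i _ do rewrite mul1r.
  move/eqP; rewrite eq_sym addrC -subr_eq0 addrK => /eqP E.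
  rewrite -[RHS]E; apply: eq_bigr => i _; apply: eq_bigr => j _; by rewrite !mul1r.
exists h => v w; have := T0 v w.
rewrite even_split (quadratic_vanish K0).
rewrite [X in _ + _ * X](eq_bigr (fun i => h i * (v i * w i)))// => i _.
by rewrite /K eqxx.
Qed.

End SignAverage.

(** * Invariance of the cone and failure of the splitting *)

Section GeneratorFlow.
Variables (R : realType) (k n : nat).
Hypotheses (hk : (k <= 3)%N) (hn : (3 <= n)%N) (hO : k = 3%N -> n = 3%N).
Local Notation H := (herm_mx R k n).
Local Notation K := (psd_cone R k n).
Let law := herm_jordan_law (R := R) hk hO.
Local Notation J := (herm_euclidean_jordan law).

Lemma genB_one : genB R k n (herm_one R k n) = 0.
Proof.
apply: val_inj; change (vsval (genB R k n (herm_one R k n)) = 0).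
rewrite genBE herm_oneE; apply/ffunP => -[l m].
rewrite ffunE /= [RHS]ffunE; have [_|lm] := eqVneq l m.
  by rewrite /mx_one !ffunE /= !eqxx subrr scaler0.
rewrite /mx_one !ffunE /= [m == l]eq_sym (negPf lm) (linear0 (@cd_conj R k)).
by rewrite !scaler0; case: (l < m)%N.
Qed.

Lemma psd_dualP x : K x <-> dual_psd J {:subvs_of H} x.
Proof.
rewrite (psd_cone_dual law); split=> [psdx u _|psdx u]; first exact: psdx.
by apply: psdx; exact: memvf.
Qed.

Lemma genB_flow t : 0 <= t -> lexp (t *: genB R k n) @` K `<=` K.
Proof.
move=> t0 _ [x /psd_dualP psdx <-]; apply/psd_dualP.
apply: flow_dual => //; first exact: genB_one.
move=> z y /psd_dualP psdz zyy; apply: (genB_cross_positive hk hO) => //.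
  by rewrite ltnW.
by apply/psd_coneP; exists y.
Qed.

(** Real vectors suffice to refute a splitting; their outer products are positive
    over all four algebras. *)
Definition rank1 (v : 'I_n -> R) : subvs_of H := vsproj H (outer (fun i => v i *: cd_one R k)).

Lemma rank1_psd v : K (rank1 v).
Proof. exact: outer_psd (@coherent_real R k n v). Qed.

Lemma herm_ip_rank1 (z : subvs_of H) v : herm_ip z (rank1 v) =
  \sum_i \sum_j v i * v j * cd_ip (vsval z (i, j)) (cd_one R k).
Proof. by rewrite /herm_ip vsprojK ?outer_herm// mxip_real. Qed.

Lemma outer_real_entry (v : 'I_n -> R) i j :
  outer (fun i => v i *: cd_one R k) (i, j) = (v i * v j) *: cd_one R k.
Proof.
by rewrite ffunE /= cd_conjZ cd_conj_one cd_mulZl cd_mulZr cd_mul1l scalerA.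
Qed.

Lemma rank1E v i j : vsval (rank1 v) (i, j) = (v i * v j) *: cd_one R k.
Proof.
by rewrite vsprojK ?outer_herm// outer_real_entry.
Qed.

Lemma herm_ip_rank1_ge0 z v : K z -> 0 <= herm_ip z (rank1 v).
Proof.
by move=> /(psd_cone_dual law) psdz; have /psd_coneP[y ->] := rank1_psd v; exact: psdz.
Qed.

Lemma herm_ip_rank1_orth v w : \sum_i v i * w i = 0 -> herm_ip (rank1 v) (rank1 w) = 0.
Proof.
move=> vw0; rewrite herm_ip_rank1.
rewrite (eq_bigr (fun i => v i * w i * \sum_j v j * w j)) => [|i _].
  by rewrite -mulr_suml vw0 mulr0.
rewrite mulr_sumr; apply: eq_bigr => j _.
by rewrite rank1E cd_ipZl cd_ip_one; ring.
Qed.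

Lemma genB_rank1 v w :
  herm_ip (genB R k n (rank1 v)) (rank1 w) = cyclic_form v w.
Proof.
rewrite herm_ip_rank1 /cyclic_form -sumrB; apply: eq_bigr => l _.
rewrite genBE (bigD1 l)//= [\sum_m off_rate _ _ _ * _ * _](bigD1 l)//= opprD addrA.
congr (_ + _).
  rewrite ffunE /= eqxx !rank1E -scalerBl scalerA cd_ipZl cd_ip_one.
  rewrite /off_rate eqxx -[if _ then 1 else _]/(diag_rate R l).
  by move: (diag_rate R l) => c; ring.
rewrite -sumrN; apply: eq_bigr => m ml.
rewrite ffunE /= /off_rate [l == m]eq_sym (negPf ml) !rank1E cd_conjZ cd_conj_one.
rewrite !scalerA.
have [lm|lm|/val_inj lm] := ltngtP l m; last by rewrite lm eqxx in ml.
  rewrite cd_ipZl cd_ip_one [m == _ :> nat]gtn_eqF ?orbF ?(leq_trans _ lm)//.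
  by case: ifP => _; ring.
rewrite cd_ipZl cd_ip_one [l == _ :> nat]gtn_eqF ?(leq_trans _ lm)//=.
by case: ifP => _; ring.
Qed.

Lemma herm_ip_scalar_l (y : subvs_of H) : scalar (fun x => herm_ip x y).
Proof. by move=> a u v; rewrite ![herm_ip _ y]herm_ipC herm_ip_scalar. Qed.

(** The function [t |-> <exp (t A) v v^T, w w^T>] is nonnegative for all real [t],
    as both factors are positive, and it vanishes at [t = 0]: this is an interior
    minimum. *)
Lemma cone_g_orth A v w : cone_g K A -> \sum_i v i * w i = 0 ->
  herm_ip (A (rank1 v)) (rank1 w) = 0.
Proof.
move=> gA vw0.
pose phi (X : 'End(subvs_of H)) := herm_ip (X (rank1 v)) (rank1 w).
have phil : scalar phi by exact: apply_scalar (herm_ip_scalar_l (rank1 w)).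
pose g (t : R) := phi (lexp (t *: A)).
have dg t := lexp_derive A t phil.
have g0 : g 0 = 0 by rewrite /g lexp0// /phi id_lfunE herm_ip_rank1_orth.
have g_ge0 t : 0 <= g t.
  apply: herm_ip_rank1_ge0; have [_ <-] := gA t.
  by exists (rank1 v) => //; exact: rank1_psd.
have g_min : is_derive 0 (1 : R) g 0.
  apply: (@derive1_at_min _ g (-1) 1).
  - lra.
  - by move=> t _; case: (dg t).
  - by rewrite in_itv/=; apply/andP; split; lra.
  - by move=> t _; rewrite g0.
have := @derive_val _ _ _ _ _ _ _ (dg 0); rewrite (@derive_val _ _ _ _ _ _ _ g_min).
rewrite (lexp0 A (comp_scalar A phil)) comp_lfun1r.
by [].
Qed.

(** The quartic form [T] of [A1] is nonnegative, and on orthogonal pairs it equals the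
    form of the generator because [A2] does not contribute there. *)
Lemma genB_not_split : ~ (exists A1 A2 : 'End(subvs_of H),
  [/\ cone_End K A1, cone_g K A2 & genB R k n = A1 + A2]).
Proof.
move=> [A1 [A2 [EA1 gA2 BE]]].
(* The matrix [E i j] need not be hermitian; projecting it to the hermitian
   matrices makes [rank1 v] bilinear in [v] without symmetrised coefficients. *)
pose E i j : cdmx R k n := [ffun p => (p == (i, j))%:R *: cd_one R k].
pose T i j l m := cd_ip (vsval (A1 (vsproj H (E i j))) (l, m)) (cd_one R k).
have rank1_sum v : rank1 v = \sum_i \sum_j (v i * v j) *: vsproj H (E i j).
  transitivity (vsproj H (\sum_i \sum_j (v i * v j) *: E i j)); last first.
    rewrite linear_sum; apply: eq_bigr => i _; rewrite linear_sum.
    by apply: eq_bigr => j _; rewrite linearZ.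
  have ffun_sum (F : 'I_n -> cdmx R k n) p : (\sum_i F i) p = \sum_i F i p.
    by apply: (big_morph (fun X : cdmx R k n => X p)) => [X Y|]; rewrite ffunE.
  congr (vsproj H _); apply/ffunP => -[a b].
  rewrite [LHS]outer_real_entry ffun_sum (bigD1 a)//= [X in _ + X]big1 => [|i ia]; last first.
    rewrite ffun_sum big1// => j _; rewrite !ffunE xpair_eqE eq_sym (negPf ia).
    by rewrite scale0r scaler0.
  rewrite addr0 ffun_sum (bigD1 b)//= [X in _ + X]big1 => [|j jb]; last first.
    rewrite !ffunE xpair_eqE [b == j]eq_sym (negPf jb) andbF.
    by rewrite scale0r scaler0.
  by rewrite addr0 !ffunE eqxx scale1r.
have TE v w : quartic T v w = herm_ip (A1 (rank1 v)) (rank1 w).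
  have phil : scalar (fun x => herm_ip (A1 x) (rank1 w)).
    by move=> a x y; rewrite linearP herm_ip_scalar_l.
  rewrite rank1_sum /quartic.
  have sumD (f : subvs_of H -> R) (x : 'I_n -> subvs_of H) : scalar f ->
      f (\sum_i x i) = \sum_i f (x i).
    move=> fl; rewrite -(eq_bigr _ (fun i _ => scale1r (x i))) scalar_sum//.
    by apply: eq_bigr => i _; rewrite mul1r.
  rewrite [RHS](sumD _ _ phil); apply: eq_bigr => i _.
  rewrite [RHS](sumD _ _ phil); apply: eq_bigr => j _.
  rewrite [RHS](scalarM _ _ phil) herm_ip_rank1 mulr_sumr; apply: eq_bigr => l _.
  by rewrite mulr_sumr; apply: eq_bigr => m _; rewrite /T; ring.
have T_ge0 v w : 0 <= quartic T v w.
  rewrite TE; apply: herm_ip_rank1_ge0; apply: EA1.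
  by exists (rank1 v) => //; exact: rank1_psd.
have T_orth v w : \sum_i v i * w i = 0 -> quartic T v w = cyclic_form v w.
  move=> vw0; rewrite TE -genB_rank1 BE add_lfunE.
  rewrite (scalarD _ _ (herm_ip_scalar_l (rank1 w))) (cone_g_orth gA2 vw0).
  by rewrite addr0.
have [h] := cyclic_form_splitting (ltnW hn) T_ge0 T_orth.
exact: cyclic_form_rigid.
Qed.

End GeneratorFlow.

Theorem theorem6 (R : realType) (k n : nat)
    (hk : (k <= 3)%N) (hn : (3 <= n)%N) (hO : k = 3%N -> n = 3%N) :
  (forall t : R, 0 <= t ->
     lexp (t *: genB R k n) @` psd_cone R k n `<=` psd_cone R k n) /\
  ~ (exists A1 A2 : 'End(subvs_of (herm_mx R k n)),
       [/\ cone_End (psd_cone R k n) A1,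
           cone_g (psd_cone R k n) A2
         & genB R k n = A1 + A2]).
Proof.
by split; [exact: genB_flow|exact: genB_not_split].
Qed.
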